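(* In the setting of TD(0) with linear function approximation described in the context, suppose the Markov chain $\{z_k\}$ on $\mathcal{N}=\{1,\ldots,N\}$ is irreducible and aperiodic, $\bar A=\sum_{i=1}^Np_i^\infty A_i$ is Hurwitz, and $\sum_{i=1}^Np_i^\infty b_i=0$. If the step size satisfies $$0<\alpha<\min_{i\in\mathcal{N}}\left\{\bar\alpha_i,\ \frac{\lambda_{\min}(\bar G)}{|\lambda_{\min}(\tilde G_i)|\,(1-\mathbf{1}_{\tilde G_i\succeq0})}\right\},$$ then the TD(0) recursion $$\theta_{k+1}-\theta_\pi=\theta_k-\theta_\pi+\alpha\left(A_{z_k}(\theta_k-\theta_\pi)+b_{z_k}\right)$$ is mean square stable, and the mean square estimation error $\mathbb{E}\|\theta_k-\theta_\pi\|^2$ converges exponentially to its stationary value; that is, there is a constant $\delta_\infty\ge0$, independent of $\theta_0$ and of the initial distribution of $z_0$, such that for every $\theta_0$ and every initial distribution there exist $C>0$ and $\rho\in(0,1)$ with $\left|\mathbb{E}\|\theta_k-\theta_\pi\|^2-\delta_\infty\right|\le C\rho^k$ for all $k\ge0$.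
   Context: **TD(0) setting.** Let $\{s_k\}$ be the time-homogeneous Markov chain on $\mathcal{S}=\{1,\ldots,n\}$ induced by a fixed policy $\pi$, with transition matrix $P_\pi$; let $R_\pi:\mathcal{S}\to\mathbb{R}$ be the reward, $\gamma\in(0,1)$ the discount factor, $\phi:\mathcal{S}\to\mathbb{R}^d$ the feature map, and $\alpha>0$ the step size. TD(0) is $\theta_{k+1}=\theta_k-\alpha\phi(s_k)\left((\phi(s_k)-\gamma\phi(s_{k+1}))^{T}\theta_k-R_\pi(s_k)\right)$. Let $\theta_\pi\in\mathbb{R}^d$ be the solution of the projected Bellman equation for $\pi$, i.e. $\Phi\theta_\pi=\Pi(R_\pi+\gamma P_\pi\Phi\theta_\pi)$, where $\Phi$ is the matrix with rows $\phi(s)^{T}$ and $\Pi$ is the orthogonal projection onto the column space of $\Phi$ in the inner product weighted by the stationary distribution of $\{s_k\}$. Put $N=n^2$, identify $\mathcal{S}\times\mathcal{S}$ with $\mathcal{N}=\{1,\ldots,N\}$ by a fixed bijection, and let $z_k\in\mathcal{N}$ be the index of the pair $(s_{k+1},s_k)$; $\{z_k\}$ is a Markov chain with $p_{ij}=\mathbf{P}(z_{k+1}=j\mid z_k=i)$. If $i$ corresponds to $(s_{k+1},s_k)=(s',s)$, then $$A_i=\phi(s)(\gamma\phi(s')-\phi(s))^{T},\qquad b_i=\phi(s)\left(R_\pi(s)-(\phi(s)-\gamma\phi(s'))^{T}\theta_\pi\right).$$ With these definitions TD(0) takes the form displayed in the claim. Let $p_i^\infty=\lim_{k\to\infty}\mathbf{P}(z_k=i)$.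 A matrix is Hurwitz if all its eigenvalues have negative real part. **Mean square stability.** With $\zeta_k=\theta_k-\theta_\pi$ and $H_i=I+\alpha A_i$, the recursion is the Markov jump linear system $\zeta_{k+1}=H_{z_k}\zeta_k+\alpha b_{z_k}$. It is mean square stable if there exist $\mu\in\mathbb{R}^d$ and $Q\in\mathbb{R}^{d\times d}$, independent of $\zeta_0$ and of the initial distribution of $z_0$, such that $\mathbb{E}[\zeta_k]\to\mu$ and $\mathbb{E}[\zeta_k\zeta_k^{T}]\to Q$ as $k\to\infty$ for every (deterministic) $\zeta_0$ and every initial distribution of $z_0$. **Matrices in the bound.** $\bar G$ is the solution of $\bar A^{T}\bar G+\bar G\bar A=-I$. Put $X_i=A_i^{T}\bar G+\bar GA_i+I/(p_i^\infty N)$. Let $\tilde G_N=0$ and let $\tilde G_1,\ldots,\tilde G_{N-1}$ be the solution of the linear equations $\tilde G_i-\sum_{j=1}^{N-1}p_{ij}\tilde G_j=X_i$, $i=1,\ldots,N-1$. For $i\in\mathcal{N}$ set $$M_i=-A_i^{T}\bar GA_i-A_i^{T}\left(\sum_{j=1}^Np_{ij}\tilde G_j\right)-\left(\sum_{j=1}^Np_{ij}\tilde G_j\right)A_i,\qquad \tilde M_i=-A_i^{T}\left(\sum_{j=1}^Np_{ij}\tilde G_j\right)A_i.$$ These are symmetric matrices. $\lambda_{\min}$ denotes the smallest eigenvalue; $\mathbf{1}_{X\succeq0}$ equals $1$ if $X$ is positive semidefinite and $0$ otherwise; a fraction with positive numerator and denominator $0$ is interpreted as $+\infty$. Define $$\bar\alpha_i=\frac{1}{p_i^\infty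 N\,|\lambda_{\min}(M_i)|\,(1-\mathbf{1}_{M_i\succeq0})}\quad\text{if }\tilde M_i\succeq0,$$ $$\bar\alpha_i=\frac{-\lambda_{\min}(M_i)-\sqrt{\lambda_{\min}^2(M_i)-4\lambda_{\min}(\tilde M_i)/(p_i^\infty N)}}{2\lambda_{\min}(\tilde M_i)}\quad\text{otherwise.}$$ *)

(* Defs.v *)
From HB Require Import structures.
From mathcomp Require Import all_boot all_order all_algebra.
From mathcomp Require Import complex.
From mathcomp Require Import all_classical all_reals all_analysis.

Set Implicit Arguments.
Unset Strict Implicit.
Unset Printing Implicit Defensive.

Import Order.TTheory GRing.Theory Num.Theory.
Import numFieldNormedType.Exports.
Local Open Scope classical_set_scope.
Local Open Scope ring_scope.

Section Matrices.
Context {R : realType} {m : nat}.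
Implicit Types X p : 'M[R]_m.

Definition hurwitz X : Prop :=
  forall z : R[i], eigenvalue (map_mx (real_complex R) X) z -> complex.Re z < 0.

Definition psd X : Prop :=
  X^T = X /\ forall v : 'cV[R]_m, 0 <= (v^T *m X *m v) 0 0.

(* The indicator of "X is positive semidefinite". *)
Definition psd_ind X : R := if `[< psd X >] then 1 else 0.

(* For symmetric X and 0 < m the set of real eigenvalues is finite and
   nonempty, so the infimum is the smallest eigenvalue. *)
Definition lambda_min X : R := inf [set a : R | eigenvalue X a].

Definition prob_vector (nu : 'rV[R]_m) : Prop :=
  (forall i, 0 <= nu 0 i) /\ \sum_i nu 0 i = 1.

Definition stochastic p : Prop :=
  (forall i j, 0 <= p i j) /\ forall i, \sum_j p i j = 1.

Definition stationary p (nu : 'rV[R]_m) : Prop :=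
  prob_vector nu /\ nu *m p = nu.

Definition irreducible_mx p : Prop := forall i j, exists k, 0 < (p ^+ k) i j.

(* For every state i, the gcd of the return times {k >= 1 | p^k i i > 0}
   is 1. *)
Definition aperiodic_mx p : Prop :=
  forall i (g : nat),
    (forall k, (0 < k)%N -> 0 < (p ^+ k) i i -> (g %| k)%N) -> g = 1%N.

(* The Markov property is the conditional probability identity
   P(x_(k+1) = i_(k+1) | x_0 = i_0, ..., x_k = i_k) = p i_k i_(k+1),
   multiplied out so that conditioning events may be null. *)
Definition markov_chain {disp} {Omega : measurableType disp}
    (P : probability Omega R) (nu : 'rV[R]_m) p (x : nat -> Omega -> 'I_m) :
    Prop :=
  [/\ forall k i, measurable [set w | x k w = i],
      forall i, P [set w | x 0%N w = i] = (nu 0 i)%:E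
    & forall k (i : nat -> 'I_m),
        P [set w | forall l, (l <= k.+1)%N -> x l w = i l] =
        (P [set w | forall l, (l <= k)%N -> x l w = i l] *
         (p (i k) (i k.+1))%:E)%E].

End Matrices.

(* Pi is the orthogonal projection onto the column space of Phi for the inner
   product <u, v> = \sum_s nu s * u s * v s. *)
Definition weighted_projection {R : realType} {n d : nat} (nu : 'rV[R]_n)
    (Phi : 'M[R]_(n, d)) (Pi : 'M[R]_n) : Prop :=
  forall v : 'cV[R]_n,
    (exists x : 'cV[R]_d, Pi *m v = Phi *m x) /\
    (forall y : 'cV[R]_d,
       \sum_s nu 0 s * (Phi *m y) s 0 * (v - Pi *m v) s 0 = 0).

Section TD0.
Context {R : realType} {n d : nat}.
Variables (gamma : R) (phi : 'I_n -> 'cV[R]_d) (Rpi : 'I_n -> R).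

Definition feature_mx : 'M[R]_(n, d) := \matrix_(s, j) phi s j 0.

Definition projected_bellman (Ppi Pi : 'M[R]_n) (theta : 'cV[R]_d) : Prop :=
  feature_mx *m theta =
  Pi *m ((\col_s Rpi s) + gamma *: (Ppi *m (feature_mx *m theta))).

(* TD(0) along a trajectory s. *)
Fixpoint td0 (alpha : R) (s : nat -> 'I_n) (theta0 : 'cV[R]_d) (k : nat) :
    'cV[R]_d :=
  if k is l.+1 then
    let theta := td0 alpha s theta0 l in
    theta - alpha *: (phi (s l) *m
      ((phi (s l) - gamma *: phi (s l.+1))^T *m theta - (Rpi (s l))%:M))
  else theta0.

(* The fixed identification of S x S with {1, ..., N}, N = n * n, is a pair of
   mutually inverse maps idx and st; the first component of st i is s_(k+1),
   the second one is s_k. *)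
Variables (idx : 'I_n * 'I_n -> 'I_(n * n)) (st : 'I_(n * n) -> 'I_n * 'I_n).

Definition td_A (i : 'I_(n * n)) : 'M[R]_d :=
  let: (s', s) := st i in phi s *m (gamma *: phi s' - phi s)^T.

Definition td_b (theta_pi : 'cV[R]_d) (i : 'I_(n * n)) : 'cV[R]_d :=
  let: (s', s) := st i in
  phi s *m ((Rpi s)%:M - (phi s - gamma *: phi s')^T *m theta_pi).

(* P(z_(k+1) = j | z_k = i) for z_k = (s_(k+1), s_k): the old s_(k+1) must be
   the new s_k. *)
Definition pair_mx (Ppi : 'M[R]_n) : 'M[R]_(n * n) :=
  \matrix_(i, j) if (st j).2 == (st i).1 then Ppi (st i).1 (st j).1 else 0.

Definition pair_process {Omega : Type} (s : nat -> Omega -> 'I_n) (k : nat)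
    (w : Omega) : 'I_(n * n) := idx (s k.+1 w, s k w).

Definition td_error {Omega : Type} (alpha : R) (theta_pi : 'cV[R]_d)
    (s : nat -> Omega -> 'I_n) (theta0 : 'cV[R]_d) (k : nat) (w : Omega) :
    'cV[R]_d := td0 alpha (fun l => s l w) theta0 k - theta_pi.

Lemma td_errorS {Omega : Type} (alpha : R) (theta_pi : 'cV[R]_d)
    (s : nat -> Omega -> 'I_n) (theta0 : 'cV[R]_d) (k : nat) (w : Omega) :
  cancel idx st ->
  td_error alpha theta_pi s theta0 k.+1 w =
  td_error alpha theta_pi s theta0 k w +
  alpha *: (td_A (pair_process s k w) *m td_error alpha theta_pi s theta0 k w +
            td_b theta_pi (pair_process s k w)).
Proof.
move=> idxK; rewrite /td_error /td_A /td_b /pair_process idxK /=.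
set theta := td0 _ _ _ k.
set f := phi (s k w); set g := phi (s k.+1 w).
rewrite [RHS]addrAC; congr (_ - _); congr (_ + _).
rewrite -scalerN; congr (_ *: _).
rewrite -mulmxA -mulmxDr -mulmxN; congr (_ *m _).
have -> : (gamma *: g - f)^T = - (f - gamma *: g)^T.
  by rewrite -linearN /= opprB.
by rewrite mulNmx mulmxBr !opprB [RHS]addrC addrA subrK.
Qed.

(* lim P(z_k = i); the limit does not depend on the law of s_0. *)
Definition limit_prob {disp} {Omega : measurableType disp}
    (P : probability Omega R) (s : nat -> Omega -> 'I_n) (i : 'I_(n * n)) : R :=
  fine (limn (fun k => P [set w | pair_process s k w = i])).

(* nu is an arbitrary law of z_0 = (s_1, s_0): it need not be compatible with
   the transition s_0 -> s_1 under Ppi.  Convergence of vectors and matrices is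
   entrywise. *)
Definition mean_square_stable (Ppi : 'M[R]_n) (alpha : R)
    (theta_pi : 'cV[R]_d) : Prop :=
  exists (mu : 'cV[R]_d) (Q : 'M[R]_d),
  forall (theta0 : 'cV[R]_d) (nu : 'rV[R]_(n * n)), prob_vector nu ->
  forall (disp : measure_display) (Omega : measurableType disp)
    (P : probability Omega R) (s : nat -> Omega -> 'I_n),
  markov_chain P nu (pair_mx Ppi) (pair_process s) ->
  let zeta := td_error alpha theta_pi s theta0 in
  (forall a, ('E_P[fun w => zeta k w a 0%R])%E @[k --> \oo] --> (mu a 0)%:E) /\
  (forall a b, ('E_P[fun w => (zeta k w *m (zeta k w)^T) a b])%E @[k --> \oo]
     --> (Q a b)%:E).

Definition mean_square_error_converges_exponentially (Ppi : 'M[R]_n)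
    (alpha : R) (theta_pi : 'cV[R]_d) : Prop :=
  exists2 delta : R, 0 <= delta &
  forall (theta0 : 'cV[R]_d) (nu : 'rV[R]_(n * n)), prob_vector nu ->
  exists C rho : R, [/\ 0 < C, 0 < rho, rho < 1 &
  forall (disp : measure_display) (Omega : measurableType disp)
    (P : probability Omega R) (s : nat -> Omega -> 'I_n),
  markov_chain P nu (pair_mx Ppi) (pair_process s) ->
  let zeta := td_error alpha theta_pi s theta0 in
  forall k, (`| 'E_P[fun w => (\sum_a zeta k w a 0%R ^+ 2)%R] - delta%:E |
             <= (C * rho ^+ k)%:E)%E].

End TD0.

Section StepSizeBound.
Context {R : realType} {N d : nat}.
Variables (A : 'I_N -> 'M[R]_d) (p : 'M[R]_N) (pinf : 'I_N -> R).
Variables (Gbar : 'M[R]_d) (Gt : 'I_N -> 'M[R]_d).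

Definition mean_A : 'M[R]_d := \sum_i pinf i *: A i.

Definition lyapunov_eq : Prop :=
  mean_A^T *m Gbar + Gbar *m mean_A = - 1%:M.

Definition bound_X (i : 'I_N) : 'M[R]_d :=
  (A i)^T *m Gbar + Gbar *m A i + (pinf i * N%:R)^-1 *: 1%:M.

(* The N-th (last) index is the i with i.+1 = N. *)
Definition poisson_eq : Prop :=
  (forall i : 'I_N, i.+1 = N -> Gt i = 0) /\
  (forall i : 'I_N, (i.+1 < N)%N ->
     Gt i - \sum_(j < N | (j.+1 < N)%N) p i j *: Gt j = bound_X i).

Definition next_G (i : 'I_N) : 'M[R]_d := \sum_j p i j *: Gt j.

Definition bound_M (i : 'I_N) : 'M[R]_d :=
  - ((A i)^T *m Gbar *m A i) - (A i)^T *m next_G i - next_G i *m A i.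

Definition bound_Mt (i : 'I_N) : 'M[R]_d :=
  - ((A i)^T *m next_G i *m A i).

(* In \bar R, division by 0%:E is multiplication by +oo. *)
Definition alpha_bar (i : 'I_N) : \bar R :=
  let lM := lambda_min (bound_M i) in
  let lMt := lambda_min (bound_Mt i) in
  if `[< psd (bound_Mt i) >] then
    (1%:E / (pinf i * N%:R * `|lM| * (1 - psd_ind (bound_M i)))%R%:E)%E
  else
    ((- lM - Num.sqrt (lM ^+ 2 - 4 * lMt / (pinf i * N%:R))) / (2 * lMt))%:E.

Definition ratio_G (i : 'I_N) : \bar R :=
  ((lambda_min Gbar)%:E /
   (`|lambda_min (Gt i)| * (1 - psd_ind (Gt i)))%R%:E)%E.

Definition step_bound : \bar R :=
  \big[Order.min/+oo%E]_(i < N) Order.min (alpha_bar i) (ratio_G i).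

End StepSizeBound.

(* Main.v *)
Require Import Defs.
From HB Require Import structures.
From mathcomp Require Import all_boot all_order all_algebra.
From mathcomp Require Import all_classical all_reals all_analysis.
From mathcomp Require Import complex ring lra.
Import Order.TTheory GRing.Theory Num.Theory.
Import numFieldNormedType.Exports.
Local Open Scope classical_set_scope.
Local Open Scope ring_scope.
Set Implicit Arguments.
Unset Strict Implicit.
Unset Printing Implicit Defensive.

(* The jump system zeta' = H_i zeta + alpha b_i with H_i = I + alpha A_i has the
   coupled quadratic Lyapunov function G_i = Gbar + alpha Gt_i: the Lyapunov and
   Poisson equations give
     H_i^T (sum_j p_ij G_j) H_i - G_i
       = - alpha (I / (p_i^oo N) + alpha M_i + alpha^2 Mt_i),
   and the two families of bounds on alpha make the right-hand side negative
   definite and G_i positive definite.  By duality the linear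
   operators that propagate the moments E[zeta_k 1(z_k = i)] and
   E[zeta_k zeta_k^T 1(z_k = i)] contract suitable norms; the laws of z_k
   converge geometrically, since aperiodicity of the pair chain forces every
   entry of P_pi to be positive.  Hence first the means, then the second moments
   solve affine recursions with a contracting linear part and a geometrically
   convergent forcing term. *)

(** * Quadratic forms and geometric decay *)

(** The forms [G_i] act on states, while moments restricted to [z_k = i] behave like measures. What
    has to shrink is the difference between such a family and its limit, and this difference has no
    sign, so its trace pairing with the [G_i] alone controls nothing. The norm therefore tests
    against every bilinear form dominated by the Lyapunov forms. Working with rectangular [d x e]
    blocks lets one operator serve both orders of moments: the right factor is [H_i] again for
    second moments, and the scalar 1 for means, where only the left factor contracts. The limits are
    fixed points of affine maps determined by the limiting forcing term, hence independent of the
    initial data. Neither [Gbar] nor the [Gt_i] are given as symmetric. Symmetry has to be extracted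
    from their equations, because the Rayleigh bound by [lambda_min] rests on it. *)

Lemma geometric_comparison (F : numFieldType) (a : nat -> F) (rho r C : F) :
  0 <= rho -> rho < 1 -> 0 <= r -> r < 1 -> 0 <= C -> (forall k, 0 <= a k) ->
  (forall k, a k.+1 <= rho * a k + C * r ^+ k) ->
  exists K t, [/\ 0 < K, 0 < t, t < 1 & forall k, a k <= K * t ^+ k].
Proof.
move=> rho0 rho1 r0 r1 C0 a0 arec.
(* This rate exceeds [rho] strictly and is at least [r], without comparing the two. The strict gap
   to [rho] absorbs the factor [k] that resonance [rho = r] would create. *)
pose t := 1 - (1 - rho) * (1 - r) / 2.
have rho1' : 0 < 1 - rho by rewrite subr_gt0.
have r1' : 0 < 1 - r by rewrite subr_gt0.
have two : (2 : F) != 0 by rewrite pnatr_eq0.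
have t1 : t < 1 by rewrite /t ltrBlDr ltrDl divr_gt0 // mulr_gt0.
have trho : 0 < t - rho.
  have -> : t - rho = (1 - rho) * ((1 + r) / 2) by rewrite /t; field.
  by rewrite mulr_gt0 // divr_gt0 // ltr_wpDr.
have tr : r <= t.
  rewrite -subr_ge0; have -> : t - r = (1 - r) * ((1 + rho) / 2).
    by rewrite /t; field.
  by rewrite mulr_ge0 ?divr_ge0 ?(ltW r1') ?addr_ge0.
have t0 : 0 < t by apply: le_lt_trans rho0 _; rewrite -subr_gt0.
(* The middle term gives [(t - rho) * K >= C], which closes the induction; the final 1 makes the
   constant positive. *)
exists (a 0%N + C / (t - rho) + 1), t; split=> //.
  by rewrite ltr_wpDl // addr_ge0 // divr_ge0 // ltW.
elim=> [|k IH].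
  by rewrite expr0 mulr1 -addrA lerDl addr_ge0 // divr_ge0 // ltW.
apply: le_trans (arec k) _.
set K := a 0%N + _ + _ in IH *.
have : rho * a k + C * r ^+ k <= rho * (K * t ^+ k) + C * t ^+ k.
  by rewrite lerD // ler_wpM2l // lerXn2r // nnegrE // ltW.
move=> /le_trans; apply.
rewrite -subr_ge0.
have -> : K * t ^+ k.+1 - (rho * (K * t ^+ k) + C * t ^+ k) =
  ((t - rho) * K - C) * t ^+ k by rewrite exprS; ring.
apply: mulr_ge0; last by rewrite exprn_ge0 ?(ltW t0).
have -> : (t - rho) * K - C = (t - rho) * (a 0%N + 1).
  by rewrite /K; field; rewrite gt_eqF.
by rewrite mulr_ge0 ?(ltW trho) // addr_ge0.
Qed.

Definition mxnorm1 (F : numFieldType) m n (X : 'M[F]_(m, n)) : F :=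
  \sum_i \sum_j `|X i j|.

Lemma mxnorm1_ge0 (F : numFieldType) m n (X : 'M[F]_(m, n)) : 0 <= mxnorm1 X.
Proof. by apply: sumr_ge0 => i _; apply: sumr_ge0. Qed.

Lemma mxnorm1D (F : numFieldType) m n (X Y : 'M[F]_(m, n)) :
  mxnorm1 (X + Y) <= mxnorm1 X + mxnorm1 Y.
Proof.
rewrite -big_split ler_sum // => i _; rewrite -big_split ler_sum // => j _.
by rewrite mxE ler_normD.
Qed.

Lemma mxnorm1Z (F : numFieldType) m n c (X : 'M[F]_(m, n)) :
  mxnorm1 (c *: X) = `|c| * mxnorm1 X.
Proof.
rewrite mulr_sumr; apply: eq_bigr => i _; rewrite mulr_sumr.
by apply: eq_bigr => j _; rewrite mxE normrM.
Qed.

Lemma le_mxnorm1 (F : numFieldType) m n (X : 'M[F]_(m, n)) i j :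
  `|X i j| <= mxnorm1 X.
Proof.
rewrite /mxnorm1 (bigD1 i) //= (bigD1 j) //= -addrA lerDl addr_ge0 //.
  by apply: sumr_ge0.
by apply: sumr_ge0 => k _; apply: sumr_ge0.
Qed.

(* A factor [X - z%:P] of an annihilating polynomial is removed through the
   scalar recursion [u_(k+1) = z u_k + e_k] with [e_k] decaying. *)
Lemma expmx_geometric (F : numClosedFieldType) n (M : 'M[F]_n.+1) :
  (forall z, eigenvalue M z -> `|z| < 1) ->
  exists K t, [/\ 0 < K, 0 < t, t < 1 &
    forall k, mxnorm1 (M ^+ k) <= K * t ^+ k].
Proof.
move=> Mlt1; pose geo (X : 'M[F]_n.+1) := exists K t, [/\ 0 < K, 0 < t, t < 1 &
    forall k, mxnorm1 (M ^+ k * X) <= K * t ^+ k].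
have peel z X : `|z| < 1 -> geo ((M - z%:M) * X) -> geo X.
  move=> z1 [K [t [K0 t0 t1 Kt]]].
  apply: (@geometric_comparison _ _ `|z| t K) => //; rewrite ?ltW //.
    by move=> k; apply: mxnorm1_ge0.
  move=> k; have -> : M ^+ k.+1 * X = z *: (M ^+ k * X) + M ^+ k * ((M - z%:M) * X).
    rewrite mulrBl mulrBr mulrA -exprSr; rewrite -scalemx1 -scalerAl mul1r.
    by rewrite -scalerAr addrC subrK.
  by apply: le_trans (mxnorm1D _ _) _; rewrite mxnorm1Z lerD2l.
have [rs charE] := closed_field_poly_normal (char_poly M).
rewrite (monicP (char_poly_monic M)) scale1r in charE.
have rs_lt1 z : z \in rs -> `|z| < 1.
  by move=> zrs; apply: Mlt1; rewrite eigenvalue_root_char charE root_prod_XsubC.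
have all_peel (ts : seq F) X : (forall z, z \in ts -> `|z| < 1) ->
    geo (horner_mx M (\prod_(z <- ts) ('X - z%:P)) * X) -> geo X.
  elim: ts X => [|z ts IH] X lt1; first by rewrite big_nil rmorph1 mul1r.
  rewrite big_cons rmorphM /= rmorphB /= horner_mx_X horner_mx_C -mulrA.
  move=> /peel gX; apply: IH; first by move=> y yts; rewrite lt1 // inE yts orbT.
  by apply: gX; rewrite lt1 // mem_head.
suff [K [t [K0 t0 t1 Kt]]] : geo 1.
  by exists K, t; split=> // k; rewrite -[M ^+ k]mulr1.
apply: (all_peel rs) => //; rewrite -charE Cayley_Hamilton mul0r.
exists 1, 2^-1; rewrite invr_gt0 invf_lt1 ?ltr1n //; split=> // k.
rewrite mulr0 mul1r; apply: (@le_trans _ _ 0).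
  by rewrite /mxnorm1 big1 // => i _; rewrite big1 // => j _; rewrite mxE normr0.
by rewrite exprn_ge0 // invr_ge0.
Qed.

Section RealForms.
Variable R : realType.

Definition bform m n (X : 'M[R]_(m, n)) (u : 'cV_m) (v : 'cV_n) : R :=
  (u^T *m X *m v) 0 0.
Definition sqnorm m (u : 'cV[R]_m) : R := (u^T *m u) 0 0.

Lemma bformE m n (X : 'M[R]_(m, n)) u v :
  bform X u v = \sum_i \sum_j u i 0 * X i j * v j 0.
Proof.
rewrite /bform mxE exchange_big; apply: eq_bigr => j _.
by rewrite mxE mulr_suml; apply: eq_bigr => i _; rewrite mxE.
Qed.

Lemma sqnormE m (u : 'cV[R]_m) : sqnorm u = \sum_i u i 0 ^+ 2.
Proof. by rewrite /sqnorm mxE; apply: eq_bigr => i _; rewrite mxE expr2. Qed.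

Lemma sqnorm_ge0 m (u : 'cV[R]_m) : 0 <= sqnorm u.
Proof. by rewrite sqnormE sumr_ge0 // => i _; rewrite sqr_ge0. Qed.

Lemma sqnorm_gt0 m (u : 'cV[R]_m) : u != 0 -> 0 < sqnorm u.
Proof.
move=> u0; rewrite lt_neqAle sqnorm_ge0 andbT; apply: contra u0.
rewrite eq_sym sqnormE psumr_eq0 => [/allP h|i _]; last by rewrite sqr_ge0.
apply/eqP/colP => i; rewrite mxE; apply/eqP; rewrite -sqrf_eq0.
by apply: h; rewrite mem_index_enum.
Qed.

Lemma bformD m n (X Y : 'M[R]_(m, n)) u v :
  bform (X + Y) u v = bform X u v + bform Y u v.
Proof. by rewrite /bform mulmxDr mulmxDl mxE. Qed.

Lemma bformN m n (X : 'M[R]_(m, n)) u v : bform (- X) u v = - bform X u v.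
Proof. by rewrite /bform mulmxN mulNmx mxE. Qed.

Lemma bformZ m n c (X : 'M[R]_(m, n)) u v :
  bform (c *: X) u v = c * bform X u v.
Proof. by rewrite /bform -scalemxAr -scalemxAl mxE. Qed.

Lemma bform_sum m n (I : finType) (P : pred I) (X : I -> 'M[R]_(m, n)) u v :
  bform (\sum_(i | P i) X i) u v = \sum_(i | P i) bform (X i) u v.
Proof. by rewrite /bform mulmx_sumr mulmx_suml summxE. Qed.

Lemma bformZl m n c (X : 'M[R]_(m, n)) u v :
  bform X (c *: u) v = c * bform X u v.
Proof. by rewrite /bform linearZ /= -!scalemxAl mxE. Qed.

Lemma bformZr m n c (X : 'M[R]_(m, n)) u v :
  bform X u (c *: v) = c * bform X u v.
Proof. by rewrite /bform -scalemxAr mxE. Qed.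

Lemma bform1 m (u : 'cV[R]_m) : bform 1%:M u u = sqnorm u.
Proof. by rewrite /bform mulmx1. Qed.

Lemma bform_congr m n p q (X : 'M[R]_(m, n)) (H : 'M[R]_(m, p))
    (K : 'M[R]_(n, q)) u v :
  bform (H^T *m X *m K) u v = bform X (H *m u) (K *m v).
Proof. by rewrite /bform trmx_mul !mulmxA. Qed.

Lemma bform_delta m n (X : 'M[R]_(m, n)) i j :
  bform X (delta_mx i 0) (delta_mx j 0) = X i j.
Proof.
by rewrite /bform trmx_delta -rowE -colE !mxE.
Qed.

Lemma bform_le m n (X : 'M[R]_(m, n)) u v :
  `|bform X u v| <= mxnorm1 X * (sqnorm u + sqnorm v).
Proof.
have le_sq p (x : 'cV[R]_p) i : x i 0 ^+ 2 <= sqnorm x.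
  by rewrite sqnormE (bigD1 i) //= lerDl sumr_ge0 // => j _; rewrite sqr_ge0.
rewrite bformE mulr_suml; apply: le_trans (ler_norm_sum _ _ _) _.
apply: ler_sum => i _; rewrite mulr_suml.
apply: le_trans (ler_norm_sum _ _ _) _; apply: ler_sum => j _.
rewrite mulrAC normrM mulrC ler_wpM2l // normrM.
apply: le_trans (lerD (le_sq _ u i) (le_sq _ v j)).
rewrite -(real_normK (num_real (u i 0))) -(real_normK (num_real (v j 0))).
move: `|u i 0| `|v j 0| (normr_ge0 (u i 0)) (normr_ge0 (v j 0)) => x y x0 y0.
nra.
Qed.

End RealForms.

(** * The smallest eigenvalue as a lower bound of a quadratic form *)

Section LambdaMin.
Variables (R : realType) (m : nat).
Implicit Types (X : 'M[R]_m) (u : 'cV[R]_m).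

Let toC := real_complex R.

(* Diagonalize the complexification in a unitary eigenbasis. *)
Lemma rayleigh_ge X l u : X^T = X -> (forall a, eigenvalue X a -> l <= a) ->
  l * sqnorm u <= bform X u u.
Proof.
move=> Xsym lX; pose XC := map_mx toC X; pose P := spectralmx XC.
pose D := spectral_diag XC.
have XCherm : XC \is hermsymmx.
  apply: realsym_hermsym.
    by apply/is_hermitianmxP; rewrite expr0 scale1r map_mx_id // map_trmx Xsym.
  by apply/mxOverP => i j; rewrite mxE complex_real.
have Dreal i : (complex.Re (D 0 i))%:C%C = D 0 i.
  by apply: RRe_real; apply/mxOverP/hermitian_spectral_diag_real.
have Pu : P \in unitmx by apply: spectral_unit.
have XE : XC = invmx P *m diag_mx D *m P.
  by apply/orthomx_spectralP/hermitian_normalmx.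
(* Row [i] of [P] is a left eigenvector for [D 0 i], and a real eigenvalue of the complexification
   is an eigenvalue of [X] itself. *)
have lD i : l <= complex.Re (D 0 i).
  apply: lX; rewrite -(eigenvalue_map toC) /= /toC Dreal.
  apply/eigenvalueP; exists (row i P).
    rewrite -row_mul -/XC [X in P *m X]XE -!mulmxA mulKVmx //.
    by rewrite mul_diag_mx; apply/rowP => j; rewrite !mxE.
  apply/eqP => /(congr1 (mulmx^~ (invmx P))).
  rewrite -row_mul mulmxV // mul0mx => /rowP/(_ i).
  by rewrite !mxE eqxx => /eqP; rewrite oner_eq0.
pose uC := map_mx toC u; pose y := P *m uC.
have uCE : uC^T = map_mx Num.conj (uC^T).
  by apply/rowP => j; rewrite !mxE /toC [RHS]conjc_real.
have yE : map_mx Num.conj (y^T) = uC^T *m invmx P.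
  by rewrite trmx_mul map_mxM -uCE invmx_unitary ?spectral_unitarymx.
have sqE : toC (sqnorm u) = \sum_i `|y i 0| ^+ 2.
  have -> : toC (sqnorm u) = (uC^T *m uC) 0 0.
    by rewrite /sqnorm /uC map_trmx -map_mxM !mxE.
  have -> : uC^T *m uC = map_mx Num.conj (y^T) *m y by rewrite yE mulmxA mulmxKV.
  by rewrite mxE; apply: eq_bigr => i _; rewrite !mxE normCKC.
have bE : toC (bform X u u) = \sum_i D 0 i * `|y i 0| ^+ 2.
  have -> : toC (bform X u u) = (uC^T *m XC *m uC) 0 0.
    by rewrite /bform /uC /XC map_trmx -!map_mxM !mxE.
  have -> : uC^T *m XC *m uC = map_mx Num.conj (y^T) *m diag_mx D *m y.
    by rewrite yE XE !mulmxA.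
  rewrite mxE; apply: eq_bigr => i _.
  by rewrite mul_mx_diag !mxE normCKC mulrAC mulrC mulrA.
have lM : toC (l * sqnorm u) = toC l * toC (sqnorm u) by exact: rmorphM.
rewrite -lecR -/(toC _) lM sqE -/(toC (bform X u u)) bE mulr_sumr.
apply: ler_sum => i _.
by rewrite ler_wpM2r ?exprn_ge0 // -Dreal lecR.
Qed.

(** An infimum lies below the members of its set only if that set is bounded below; [bform_le] at an
    eigenvector supplies the bound [- 2 * mxnorm1 X]. *)
Lemma lambda_min_le X u : X^T = X -> lambda_min X * sqnorm u <= bform X u u.
Proof.
move=> Xsym; apply: rayleigh_ge => // a aX; apply: ge_inf => //.
exists (- (mxnorm1 X *+ 2)) => b /eigenvalueP[v vX v0].
have /sqnorm_gt0 vT0 : v^T != 0 by rewrite -trmx0 (inj_eq trmx_inj).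
have : bform X v^T v^T = b * sqnorm v^T.
  by rewrite /bform /sqnorm trmxK vX -scalemxAl mxE.
move=> bE; have := bform_le X v^T v^T; rewrite bE => /ler_normlP[+ _].
rewrite -mulr2n mulrnAr -mulrnAl => bX.
by rewrite lerNl -(ler_pM2r vT0) mulNr.
Qed.

Lemma lambda_min_lt0 X : X^T = X -> ~ psd X -> lambda_min X < 0.
Proof.
move=> Xsym notpsd; rewrite ltNge; apply/negP => l0; apply: notpsd.
split=> // u; apply: le_trans (lambda_min_le u Xsym).
by rewrite mulr_ge0 ?sqnorm_ge0.
Qed.

End LambdaMin.

(** * The Lyapunov equation of a Hurwitz matrix *)

Lemma mxnorm1M (F : numFieldType) m n p (X : 'M[F]_(m, n)) (Y : 'M[F]_(n, p)) :
  mxnorm1 (X *m Y) <= mxnorm1 X * mxnorm1 Y.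
Proof.
rewrite mulr_suml ler_sum // => i _.
apply: (@le_trans _ _ (\sum_k \sum_j `|X i j| * `|Y j k|)).
  apply: ler_sum => k _; rewrite mxE; apply: le_trans (ler_norm_sum _ _ _) _.
  by apply: ler_sum => j _; rewrite normrM.
rewrite exchange_big mulr_suml ler_sum // => j _; rewrite -mulr_sumr.
rewrite ler_wpM2l // /mxnorm1 [leRHS](bigD1 j) //= lerDl.
by apply: sumr_ge0 => l _; apply: sumr_ge0.
Qed.

Lemma mxnorm1_tr (F : numFieldType) m n (X : 'M[F]_(m, n)) :
  mxnorm1 X^T = mxnorm1 X.
Proof.
rewrite /mxnorm1 exchange_big; apply: eq_bigr => i _.
by apply: eq_bigr => j _; rewrite mxE.
Qed.

Lemma le0_geometric (R : realType) (x C t : R) : 0 <= t -> t < 1 ->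
  (forall k, x <= C * t ^+ k) -> x <= 0.
Proof.
move=> t0 t1 xC.
have Ct : (fun k => C * t ^+ k) @ \oo --> C * 0.
  by apply: cvgM; [exact: cvg_cst|apply: cvg_expr; rewrite ger0_norm].
rewrite mulr0 in Ct; apply: (@cvgr_to_ge _ _ _ _ _ _ _ Ct).
by apply: nearW.
Qed.

Section Lyapunov.
Variables (R : realType) (n : nat) (A : 'M[R]_n.+1).
Hypothesis hurwitzA : hurwitz A.

Let toC := real_complex R.
Let U := 1 - A.

Lemma hurwitz_1B_unit : U \in unitmx.
Proof.
apply/negPn/negP; rewrite -row_free_unit -kermx_eq0 => /rowV0Pn[v].
move=> /sub_kermxP; rewrite mulmxBr mulmx1 => /eqP; rewrite subr_eq0 => /eqP vA v0.
have : eigenvalue (map_mx toC A) (toC 1).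
  by rewrite eigenvalue_map; apply/eigenvalueP; exists v; rewrite // scale1r.
by move=> /hurwitzA /=; rewrite ltr10.
Qed.

(* [cayley^T D cayley - D] is congruent to [2 (A^T D + D A)], so a Lyapunov
   equation becomes a discrete one without a small step, and the powers of the
   transform decay because its eigenvalues [(1 + l) / (1 - l)] lie in the unit
   disc. *)
Definition cayley := (1 + A) *m invmx U.

Lemma cayley_eigenvalue z : eigenvalue (map_mx toC cayley) z -> `|z| < 1.
Proof.
move=> /eigenvalueP[v vB v0].
have : v *m map_mx toC (1 + A) = z *: (v *m map_mx toC U).
  rewrite scalemxAl -vB -mulmxA -map_mxM /cayley mulmxKV //.
  exact: hurwitz_1B_unit.
rewrite /U map_mxD map_mxB map_mx1 mulmxDr mulmxBr mulmx1 scalerBr.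
move=> eqv; have {eqv} vA : (1 + z) *: (v *m map_mx toC A) = (z - 1) *: v.
  rewrite scalerDl scalerBl !scale1r; apply/eqP.
  by rewrite eq_sym subr_eq addrC addrA eqv subrK.
(* The value [z = -1] would correspond to an infinite eigenvalue of [A]; it forces [-2 v = 0]. *)
have z1 : 1 + z != 0.
  apply/eqP => z1; move: vA; rewrite z1 scale0r => /esym/eqP.
  rewrite scaler_eq0 (negPf v0) orbF subr_eq0 => /eqP zE.
  by move/eqP: z1; rewrite zE -(natrD _ 1 1) pnatr_eq0.
pose l := (z - 1) / (1 + z).
have /hurwitzA l0 : eigenvalue (map_mx toC A) l.
  apply/eigenvalueP; exists v => //.
  by apply: (scalerI z1); rewrite vA scalerA /l mulrCA divff ?mulr1.
have zl : z * (1 - l) = 1 + l by rewrite /l; field.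
(* The squared moduli differ by [4 Re l], which is negative. *)
have norm_lt : `|1 + l| < `|1 - l|.
  rewrite -ltr_sqr ?nnegrE // -!add_Re2_Im2 ltcR.
  by case: l l0 {zl} => a b /= a0; nra.
have l1 : 0 < `|1 - l| by apply: le_lt_trans norm_lt.
by rewrite -(ltr_pM2r l1) mul1r -normrM zl.
Qed.

(** The complex constants of [expmx_geometric] are positive, hence real, so passing to real parts
    loses nothing. *)
Lemma cayley_geometric : exists K t, [/\ 0 < K, 0 < t, t < 1 &
  forall k, mxnorm1 (cayley ^+ k) <= K * t ^+ k].
Proof.
have [K [t [K0 t0 t1 Kt]]] := expmx_geometric cayley_eigenvalue.
have KE : (complex.Re K)%:C%C = K by apply/RRe_real/gtr0_real.
have tE : (complex.Re t)%:C%C = t by apply/RRe_real/gtr0_real.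
exists (complex.Re K), (complex.Re t); rewrite -!ltcR KE tE; split=> // k.
have normE : (mxnorm1 (cayley ^+ k))%:C%C = mxnorm1 (map_mx toC cayley ^+ k).
  rewrite -[RHS]/(mxnorm1 (map_mx (real_complex R) cayley ^+ k)).
  rewrite -rmorphXn /= /mxnorm1 rmorph_sum; apply: eq_bigr => i _.
  rewrite rmorph_sum; apply: eq_bigr => j _; rewrite mxE normc_def /=.
  by rewrite expr0n addr0 sqrtr_sqr.
have KtE : (complex.Re K * complex.Re t ^+ k)%:C%C = K * t ^+ k.
  rewrite -[in RHS]KE -[in RHS]tE -(rmorphXn (real_complex R)).
  exact: (rmorphM (real_complex R)).
by rewrite -lecR normE KtE.
Qed.

(** The forms [(1 + A)^T D (1 + A)] and [(1 - A)^T D (1 - A)] share the terms [D] and [A^T D A];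
    only the mixed terms change sign. *)
Lemma cayley_conj (D : 'M[R]_n.+1) :
  cayley^T *m D *m cayley =
  D + (invmx U)^T *m (2 *: (A^T *m D + D *m A)) *m invmx U.
Proof.
have Uu := hurwitz_1B_unit.
have UT : U^T \in unitmx by rewrite unitmx_tr.
have -> : cayley^T *m D *m cayley =
    (invmx U)^T *m ((1 + A)^T *m D *m (1 + A)) *m invmx U.
  by rewrite /cayley trmx_mul !mulmxA.
have -> : (1 + A)^T *m D *m (1 + A) =
    U^T *m D *m U + 2 *: (A^T *m D + D *m A).
  rewrite /U !linearD !linearN /= trmx1 !(mulmxDl, mulmxDr, mulmx1, mul1mx).
  rewrite !(mulNmx, mulmxN, mulmx1, mul1mx) scaler_nat mulr2n.
  rewrite !opprD !opprK; apply/matrixP => i j; rewrite !mxE; ring.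
rewrite mulmxDr mulmxDl trmx_inv; congr (_ + _).
by rewrite !mulmxA mulVmx // mul1mx mulmxK.
Qed.

Lemma cayley_conj_le (D : 'M[R]_n.+1) : exists C t, [/\ 0 <= t, t < 1 &
  forall k, mxnorm1 ((cayley ^+ k)^T *m D *m cayley ^+ k) <= C * t ^+ k].
Proof.
have [K [t [K0 t0 t1 Kt]]] := cayley_geometric.
exists (K * mxnorm1 D * K), (t * t); split; rewrite ?mulr_ge0 ?ltW //.
  by rewrite mulr_ilt1 ?(ltW t0).
move=> k; apply: le_trans (mxnorm1M _ _) _.
have -> : K * mxnorm1 D * K * (t * t) ^+ k = K * t ^+ k * mxnorm1 D * (K * t ^+ k).
  by rewrite exprMn; ring.
rewrite ler_pM ?mxnorm1_ge0 //; apply: le_trans (mxnorm1M _ _) _.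
by rewrite mxnorm1_tr ler_wpM2r ?mxnorm1_ge0.
Qed.

(** Such a [D] is invariant under congruence by [cayley], hence under congruence by all its powers,
    and these decay. *)
Lemma lyapunov_homogeneous (D : 'M[R]_n.+1) :
  A^T *m D + D *m A = 0 -> D = 0.
Proof.
move=> D0; have DE k : (cayley ^+ k)^T *m D *m cayley ^+ k = D.
  elim: k => [|k IH]; first by rewrite expr0 trmx1 mul1mx mulmx1.
  have -> : (cayley ^+ k.+1)^T *m D *m cayley ^+ k.+1 =
      cayley^T *m ((cayley ^+ k)^T *m D *m cayley ^+ k) *m cayley.
    by rewrite exprSr -[_ * cayley]/(_ *m _) trmx_mul !mulmxA.
  rewrite IH.
  by rewrite cayley_conj D0 scaler0 mulmx0 mul0mx addr0.
have [C [t [t0 t1 Ct]]] := cayley_conj_le D.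
have D_le0 : mxnorm1 D <= 0.
  by apply: (le0_geometric t0 t1 (C := C)) => k; rewrite -{1}(DE k).
apply/matrixP => i j; rewrite mxE; apply/eqP; rewrite -normr_le0.
exact: le_trans (le_mxnorm1 _ _ _) D_le0.
Qed.

Variable G : 'M[R]_n.+1.
Hypothesis lyapG : A^T *m G + G *m A = - 1%:M.

(** Transposing the equation shows that [G^T] solves it too, so uniqueness applies. *)
Lemma lyapunov_sym : G^T = G.
Proof.
apply/eqP; rewrite -subr_eq0; apply/eqP; apply: lyapunov_homogeneous.
rewrite mulmxBr mulmxBl addrACA -opprD lyapG.
have -> : A^T *m G^T + G^T *m A = (A^T *m G + G *m A)^T.
  by rewrite linearD /= !trmx_mul trmxK addrC.
by rewrite lyapG linearN /= trmx1 subrr.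
Qed.

(** Along an orbit of [cayley] the form drops by [2 |U^-1 u|^2] per step and tends to 0, so it is
    nonnegative everywhere; the first drop alone then gives a strict lower bound. *)
Lemma lyapunov_pos :
  exists2 g, 0 < g & forall u, g * sqnorm u <= bform G u u.
Proof.
have Uu := hurwitz_1B_unit.
pose f k u := bform G (cayley ^+ k *m u) (cayley ^+ k *m u).
have stepE u : bform G u u =
    bform G (cayley *m u) (cayley *m u) + 2 * sqnorm (invmx U *m u).
  rewrite -bform_congr cayley_conj lyapG bformD -addrA [X in _ + X]addrC.
  rewrite bform_congr bformZ bformN bform1 mulrN subrr addr0 //.
have f1_ge0 u : 0 <= bform G (cayley *m u) (cayley *m u).
  pose v := cayley *m u.
  have fdecr k : bform G v v >= bform G (cayley ^+ k *m v) (cayley ^+ k *m v).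
    elim: k => [|k IH]; first by rewrite expr0 mul1mx.
    apply: le_trans IH; rewrite (stepE (cayley ^+ k *m v)) exprS -mulmxA.
    by rewrite lerDl mulr_ge0 ?sqnorm_ge0.
  have [C [t [t0 t1 Ct]]] := cayley_conj_le G.
  rewrite -/v -oppr_le0.
  apply: (le0_geometric t0 t1 (C := C * (sqnorm v + sqnorm v))) => k.
  rewrite lerNl; apply: le_trans (fdecr k).
  rewrite -bform_congr lerNl mulrAC.
  apply: (@le_trans _ _ `|bform ((cayley ^+ k)^T *m G *m cayley ^+ k) v v|).
    by rewrite -normrN ler_norm.
  apply: le_trans (bform_le _ _ _) _.
  by rewrite ler_wpM2r // addr_ge0 ?sqnorm_ge0.
(* From [u = U (U^-1 u)] one gets [|u|^2 <= 2 c |U^-1 u|^2], which makes [1 / (c + 1)] an admissible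
   constant. *)
pose c := mxnorm1 (U^T *m 1%:M *m U).
have c0 : 0 <= c by apply: mxnorm1_ge0.
exists (c + 1)^-1 => [|u]; first by rewrite invr_gt0 ltr_wpDl.
apply: (@le_trans _ _ (2 * sqnorm (invmx U *m u))); last first.
  by rewrite (stepE u) lerDr.
rewrite ler_pdivrMl ?ltr_wpDl //.
have -> : sqnorm u = bform (U^T *m 1%:M *m U) (invmx U *m u) (invmx U *m u).
  by rewrite bform_congr bform1 mulKVmx.
apply: le_trans (ler_norm _) _; apply: le_trans (bform_le _ _ _) _.
move: (sqnorm_ge0 (invmx U *m u)); rewrite -/c.
move: (sqnorm _) => x x0; nra.
Qed.

End Lyapunov.

(** * Jump operators *)

Section ExponentialConvergence.
Variable R : realType.
Implicit Types (u v : nat -> R) (l m c : R).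

Definition expcvg u l := exists C t, [/\ 0 < C, 0 < t, t < 1 &
  forall k, `|u k - l| <= C * t ^+ k].

Lemma eq_expcvg u v l : u =1 v -> expcvg u l -> expcvg v l.
Proof.
by move=> uv [C [t [C0 t0 t1 h]]]; exists C, t; split=> // k; rewrite -uv.
Qed.

Lemma expcvg_cst c : expcvg (fun=> c) c.
Proof.
exists 1, 2^-1; rewrite invr_gt0 invf_lt1 ?ltr1n //; split=> // k.
by rewrite subrr normr0 mul1r exprn_ge0 // invr_ge0.
Qed.

Lemma expcvgD u v l m : expcvg u l -> expcvg v m ->
  expcvg (fun k => u k + v k) (l + m).
Proof.
move=> [C [t [C0 t0 t1 ul]]] [D [s [D0 s0 s1 vm]]].
exists (C + D), (Num.max t s); split; rewrite ?addr_gt0 ?lt_max ?t0 ?gt_max ?t1 //.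
move=> k; rewrite opprD addrACA; apply: le_trans (ler_normD _ _) _.
rewrite mulrDl lerD //; [apply: le_trans (ul k) _|apply: le_trans (vm k) _].
  by rewrite ler_pM2l // lerXn2r ?nnegrE ?le_max ?lexx ?(ltW t0).
by rewrite ler_pM2l // lerXn2r ?nnegrE ?le_max ?lexx ?(ltW s0) ?orbT.
Qed.

Lemma expcvgMl c u l : expcvg u l -> expcvg (fun k => c * u k) (c * l).
Proof.
move=> [C [t [C0 t0 t1 ul]]]; exists ((`|c| + 1) * C), t; split=> //.
  by rewrite mulr_gt0 // ltr_wpDl.
move=> k; rewrite -mulrBr normrM -mulrA ler_pM //.
by rewrite lerDl.
Qed.

Lemma expcvg_sum (I : finType) (P : pred I) (u : I -> nat -> R) (l : I -> R) :
  (forall i, P i -> expcvg (u i) (l i)) ->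
  expcvg (fun k => \sum_(i | P i) u i k) (\sum_(i | P i) l i).
Proof.
move=> ul; rewrite -[\sum_(i | P i) l i]big_filter.
apply: (@eq_expcvg (fun k => \sum_(i <- [seq i <- index_enum I | P i]) u i k)).
  by move=> k; rewrite big_filter.
have: all P [seq i <- index_enum I | P i] by apply: filter_all.
elim: [seq i <- index_enum I | P i] => [_|i s IH /= /andP[Pi /IH cs]].
  rewrite big_nil; apply: (eq_expcvg _ (expcvg_cst 0)).
  by move=> k; rewrite big_nil.
rewrite big_cons; apply: (eq_expcvg _ (expcvgD (ul _ Pi) cs)).
by move=> k; rewrite big_cons.
Qed.

Lemma expcvg_dist u l : expcvg u l -> expcvg (fun k => `|u k - l|) 0.
Proof.
move=> [C [t [C0 t0 t1 ul]]]; exists C, t; split=> // k.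
by rewrite subr0 normr_id.
Qed.

(** Serves the pair chain, whose law factors through the transition matrix only from time 1 on. *)
Lemma expcvg_shift u l : expcvg (fun k => u k.+1) l -> expcvg u l.
Proof.
move=> [C [t [C0 t0 t1 ul]]].
exists (`|u 0%N - l| + C / t), t; split=> //.
  by rewrite ltr_wpDl // divr_gt0.
have Ct0 : 0 < C / t by rewrite divr_gt0.
case=> [|k]; first by rewrite expr0 mulr1 lerDl ltW.
apply: le_trans (ul k) _; rewrite mulrDl exprS -[in leRHS]mulrA mulKf ?gt_eqF //.
by rewrite lerDr !mulr_ge0 ?exprn_ge0 // ltW.
Qed.

Lemma expcvg_cvg u l : expcvg u l -> u @ \oo --> l.
Proof.
move=> [C [t [C0 t0 t1 ul]]]; apply/subr_cvg0/norm_cvg0P.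
have Ct : (fun k => C * t ^+ k) @ \oo --> 0.
  rewrite -[X in _ --> X](mulr0 C); apply: cvgM; first exact: cvg_cst.
  by apply: cvg_expr; rewrite gtr0_norm.
apply: (squeeze_cvgr _ (cvg_cst 0) Ct).
by apply: nearW => k; rewrite normr_ge0 ul.
Qed.

End ExponentialConvergence.

Section JumpOperator.
Variables (R : realType) (N d e : nat) (p : 'M[R]_N).
Variables (H : 'I_N -> 'M[R]_d) (K : 'I_N -> 'M[R]_e).
Variables (G : 'I_N -> 'M[R]_d) (F : 'I_N -> 'M[R]_e) (r g : R).
Hypothesis p_ge0 : forall i j, 0 <= p i j.
Hypotheses (r_gt0 : 0 < r) (r_lt1 : r < 1) (g_gt0 : 0 < g).
Hypothesis G_contr : forall i u,
  bform (\sum_j p i j *: G j) (H i *m u) (H i *m u) <= r ^+ 4 * bform (G i) u u.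
Hypothesis F_contr : forall i v,
  bform (\sum_j p i j *: F j) (K i *m v) (K i *m v) <= bform (F i) v v.
Hypothesis G_ge : forall i u, g * sqnorm u <= bform (G i) u u.
Hypothesis F_ge : forall i v, g * sqnorm v <= bform (F i) v v.

Local Notation V := {ffun 'I_N -> 'M[R]_(d, e)}.
Implicit Types (Q : V) (S : 'I_N -> 'M[R]_(d, e)).

Definition jump_op Q : V :=
  [ffun j => \sum_i p i j *: (H i *m Q i *m (K i)^T)].

Let dual_op S i := (H i)^T *m (\sum_j p i j *: S j) *m K i.
Let pairing S Q := \sum_i \tr ((S i)^T *m Q i).
Let dual_ball c S := forall i u v,
  `|bform (S i) u v| <= c * (bform (G i) u u + bform (F i) v v).

(* The norm dual to the order-unit norm of the quadratic forms
   [G i u u + F i v v]; the operator contracts it. *)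
Let gauge Q t := forall S, dual_ball 1 S -> `|pairing S Q| <= t.

Lemma jump_op_linear : linear jump_op.
Proof.
move=> a Q Q'; apply/ffunP => j; rewrite !ffunE scaler_sumr -big_split.
apply: eq_bigr => i _ /=; rewrite !ffunE mulmxDr mulmxDl scalerDr.
by rewrite -scalemxAr -scalemxAl !scalerA mulrC.
Qed.

HB.instance Definition _ :=
  GRing.isLinear.Build R V V _ jump_op jump_op_linear.

Lemma pairing_dual S Q : pairing S (jump_op Q) = pairing (dual_op S) Q.
Proof.
transitivity (\sum_j \sum_i p i j * \tr ((S j)^T *m (H i *m Q i *m (K i)^T))).
  apply: eq_bigr => j _; rewrite ffunE mulmx_sumr raddf_sum.
  by apply: eq_bigr => i _; rewrite /= -scalemxAr mxtraceZ.
rewrite exchange_big; apply: eq_bigr => i _.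
rewrite /dual_op !trmx_mul trmxK linear_sum /= mulmx_suml mulmx_sumr.
rewrite mulmx_suml raddf_sum; apply: eq_bigr => j _ /=.
rewrite linearZ /= -scalemxAl -scalemxAr -scalemxAl mxtraceZ; congr (_ * _).
by rewrite !mulmxA mxtrace_mulC !mulmxA.
Qed.

(* The substitution [u := r^-1 u], [v := r v] splits the factor [r ^+ 4]
   evenly between the two forms. *)
Lemma dual_contr S : dual_ball 1 S -> dual_ball (r ^+ 2) (dual_op S).
Proof.
move=> S1 i u v; rewrite bform_congr.
pose u' := r^-1 *: u; pose v' := r *: v.
have -> : bform (\sum_j p i j *: S j) (H i *m u) (K i *m v) =
    bform (\sum_j p i j *: S j) (H i *m u') (K i *m v').
  by rewrite -!scalemxAr bformZl bformZr mulrA mulVf ?mul1r ?gt_eqF.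
rewrite bform_sum; apply: le_trans (ler_norm_sum _ _ _) _.
apply: (@le_trans _ _ (bform (\sum_j p i j *: G j) (H i *m u') (H i *m u') +
    bform (\sum_j p i j *: F j) (K i *m v') (K i *m v'))).
  rewrite !bform_sum -big_split ler_sum // => j _ /=; rewrite !bformZ -mulrDr.
  rewrite normrM (ger0_norm (p_ge0 i j)) ler_wpM2l //.
  by have := S1 j (H i *m u') (K i *m v'); rewrite mul1r.
rewrite mulrDr lerD //.
  apply: le_trans (G_contr i u') _; rewrite bformZl bformZr le_eqVlt.
  by apply/orP; left; apply/eqP; field; rewrite gt_eqF.
apply: le_trans (F_contr i v') _; rewrite bformZl bformZr le_eqVlt.
by apply/orP; left; apply/eqP; ring.
Qed.

Lemma pairingZ c S Q : pairing (fun i => c *: S i) Q = c * pairing S Q.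
Proof.
rewrite /pairing mulr_sumr; apply: eq_bigr => i _.
by rewrite linearZ /= -scalemxAl mxtraceZ.
Qed.

Lemma pairingD S Q Q' : pairing S (Q + Q') = pairing S Q + pairing S Q'.
Proof.
rewrite /pairing -big_split; apply: eq_bigr => i _.
by rewrite ffunE mulmxDr linearD.
Qed.

(** The adjoint maps the unit dual ball into [r ^+ 2] times itself, so dividing by [r ^+ 2] gives an
    admissible test family. *)
Lemma gauge_op Q t : gauge Q t -> gauge (jump_op Q) (r ^+ 2 * t).
Proof.
move=> Qt S S1; have r20 : 0 < r ^+ 2 by rewrite exprn_gt0.
have S'1 : dual_ball 1 (fun i => (r ^+ 2)^-1 *: dual_op S i).
  move=> i u v; rewrite bformZ normrM gtr0_norm ?invr_gt0 // mul1r.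
  by rewrite ler_pdivrMl //; apply: dual_contr.
have := Qt _ S'1; rewrite pairingZ -pairing_dual normrM gtr0_norm ?invr_gt0 //.
by rewrite ler_pdivrMl.
Qed.

Lemma gaugeD Q Q' t t' : gauge Q t -> gauge Q' t' -> gauge (Q + Q') (t + t').
Proof.
move=> Qt Qt' S S1; rewrite pairingD; apply: le_trans (ler_normD _ _) _.
by rewrite lerD ?Qt ?Qt'.
Qed.

Lemma gaugeW Q t t' : t <= t' -> gauge Q t -> gauge Q t'.
Proof. by move=> tt' Qt S /Qt/le_trans; apply. Qed.

Lemma pairingE S Q : pairing S Q = \sum_i \sum_a \sum_b S i a b * Q i a b.
Proof.
apply: eq_bigr => i _; rewrite exchange_big; apply: eq_bigr => b _.
by rewrite mxE; apply: eq_bigr => a _; rewrite mxE.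
Qed.

(** The test family equal to [g] times a matrix unit at [i], and 0 elsewhere, lies in the dual ball
    because both forms dominate [g] times the squared norm. *)
Lemma norm_le_gauge Q t i a b : gauge Q t -> `|Q i a b| <= g^-1 * t.
Proof.
move=> Qt; rewrite ler_pdivlMl //.
pose S j : 'M[R]_(d, e) := if j == i then g *: delta_mx a b else 0.
have sq m (u : 'cV[R]_m) k : u k 0 ^+ 2 <= sqnorm u.
  by rewrite sqnormE (bigD1 k) //= lerDl sumr_ge0 // => l _; rewrite sqr_ge0.
have S1 : dual_ball 1 S.
  move=> j u v; rewrite mul1r.
  apply: le_trans (lerD (G_ge j u) (F_ge j v)); rewrite /S.
  case: eqP => _; last first.
    rewrite /bform mulmx0 mul0mx mxE normr0.
    by rewrite addr_ge0 ?mulr_ge0 ?sqnorm_ge0 // ltW.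
  rewrite bformZ normrM gtr0_norm // -mulrDr ler_pM2l //.
  have -> : bform (delta_mx a b) u v = u a 0 * v b 0.
    rewrite bformE (bigD1 a) //= (bigD1 b) //= !mxE !eqxx mulr1 !big1 ?addr0 //.
      move=> k ka; rewrite big1 // => l _.
      by rewrite mxE (negPf ka) mulr0 mul0r.
    by move=> l lb; rewrite mxE (negPf lb) andbF mulr0 mul0r.
  apply: le_trans (lerD (sq _ u a) (sq _ v b)); rewrite normrM.
  rewrite -(real_normK (num_real (u a 0))) -(real_normK (num_real (v b 0))).
  move: `|u a 0| `|v b 0| (normr_ge0 (u a 0)) (normr_ge0 (v b 0)) => x y x0 y0.
  nra.
have := Qt _ S1; rewrite pairingE (bigD1 i) //= [X in _ + X]big1 => [|j ji]; last first.
  rewrite big1 // => k _; rewrite big1 // => l _.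
  by rewrite /S (negPf ji) mxE mul0r.
rewrite addr0 (bigD1 a) //= [X in _ + X]big1 => [|k ka]; last first.
  by rewrite big1 // => l _; rewrite /S eqxx !mxE (negPf ka) mulr0 mul0r.
rewrite addr0 (bigD1 b) //= [X in _ + X]big1 => [|l lb]; last first.
  by rewrite /S eqxx !mxE (negPf lb) andbF mulr0 mul0r.
by rewrite addr0 /S eqxx !mxE !eqxx mulr1 normrM gtr0_norm.
Qed.

Let c := \sum_i (mxnorm1 (G i) + mxnorm1 (F i)).

Lemma dual_radius_ge0 : 0 <= c.
Proof. by apply: sumr_ge0 => i _; rewrite addr_ge0 ?mxnorm1_ge0. Qed.

(** Finiteness of the gauge: basis vectors bound the entries of every member of the dual ball by
    [c]. *)
Lemma gauge_norm Q : gauge Q (\sum_i \sum_a \sum_b c * `|Q i a b|).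
Proof.
move=> S S1; rewrite pairingE.
apply: le_trans (ler_norm_sum _ _ _) _; apply: ler_sum => i _.
apply: le_trans (ler_norm_sum _ _ _) _; apply: ler_sum => a _.
apply: le_trans (ler_norm_sum _ _ _) _; apply: ler_sum => b _.
rewrite normrM ler_wpM2r //.
have := S1 i (delta_mx a 0) (delta_mx b 0); rewrite !bform_delta mul1r.
move=> /le_trans; apply.
rewrite /c (bigD1 i) //= -[leLHS]addr0 lerD //.
  rewrite lerD //; apply: le_trans (ler_norm _) _; exact: le_mxnorm1.
by apply: sumr_ge0 => j _; rewrite addr_ge0 ?mxnorm1_ge0.
Qed.

(** An invariant family has gauge at most [t * r ^ (2k)] for every [k], so it vanishes. Thus
    [1 - jump_op] is injective, hence onto in finite dimension. *)
Lemma jump_op_fixpoint (f : V) : exists Q, Q = jump_op Q + f.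
Proof.
pose T : 'End(V) := (\1 - linfun jump_op)%VF.
have TE Q : T Q = Q - jump_op Q by rewrite !lfun_simp.
have : lker T == 0%VS.
  apply/lker0P => Q Q' /eqP; rewrite -subr_eq0 -linearB /= TE subr_eq0 => /eqP fixD.
  apply/eqP; rewrite -subr_eq0; move: (Q - Q') fixD => {Q Q'} Q QE.
  pose t := \sum_i \sum_a \sum_b c * `|Q i a b|.
  have gk k : gauge Q (t * (r ^+ 2) ^+ k).
    elim: k => [|k /gauge_op]; first by rewrite expr0 mulr1; apply: gauge_norm.
    by rewrite -QE [_ ^+ k.+1]exprS mulrCA.
  apply/eqP/ffunP => i; apply/matrixP => a b; rewrite ffunE mxE.
  apply/eqP; rewrite -normr_le0.
  apply: (@le0_geometric _ _ (g^-1 * t) (r ^+ 2)).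
  - by rewrite exprn_ge0 // ltW.
  - by rewrite exprn_ilt1 // ltW.
  - by move=> k; rewrite -mulrA; apply: norm_le_gauge.
move=> /lker0_limgf/vspaceP/(_ f); rewrite memvf => /memv_imgP[Q _ ->].
by exists Q; rewrite TE addrC subrK.
Qed.

(** The limit is fixed before [x] and [y] are given, which is what makes it independent of the
    start. The deviation [x k - Q] obeys the same recursion with the decaying forcing [y k - f]. *)
Lemma jump_recursion_cvg (f : V) : exists Q : V, forall (x y : nat -> V),
  (forall k, x k.+1 = jump_op (x k) + y k) ->
  (forall i a b, expcvg (fun k => y k i a b) (f i a b)) ->
  forall i a b, expcvg (fun k => x k i a b) (Q i a b).
Proof.
have [Q QE] := jump_op_fixpoint f; exists Q => x y xS yf.
have [C [t [C0 t0 t1 yt]]] :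
    expcvg (fun k => \sum_i \sum_a \sum_b c * `|y k i a b - f i a b|)
      (\sum_(i < N) \sum_(a < d) \sum_(b < e) c * 0).
  apply: expcvg_sum => i _; apply: expcvg_sum => a _; apply: expcvg_sum => b _.
  by apply: expcvgMl; apply: expcvg_dist.
(* As [gauge] is a relation and not a number, an explicit scalar majorant is carried along the
   recursion. *)
pose s := fix s k := if k is l.+1 then r ^+ 2 * s l + C * t ^+ l else
  \sum_i \sum_a \sum_b c * `|(x 0%N - Q) i a b|.
have gs k : gauge (x k - Q) (s k).
  elim: k => [|k IH]; first exact: gauge_norm.
  have -> : x k.+1 - Q = jump_op (x k - Q) + (y k - f).
    by rewrite linearB xS {1}QE opprD addrACA.
  rewrite [s _]/=; apply: gaugeD; first exact: gauge_op.
  apply: gaugeW (gauge_norm _); apply: le_trans (yt k).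
  apply: le_trans (ler_norm _); rewrite le_eqVlt; apply/orP; left; apply/eqP.
  rewrite [X in _ = _ - X]big1 ?subr0 => [|i _]; last first.
    by rewrite big1 // => a _; rewrite big1 // => b _; rewrite mulr0.
  apply: eq_bigr => i _; apply: eq_bigr => a _; apply: eq_bigr => b _.
  by rewrite !ffunE !mxE.
have s_ge0 k : 0 <= s k.
  elim: k => [|k IH] /=.
    do 3!(apply: sumr_ge0 => ? _); by rewrite mulr_ge0 // dual_radius_ge0.
  by rewrite addr_ge0 ?mulr_ge0 ?exprn_ge0 // ltW.
have [] := @geometric_comparison R s (r ^+ 2) t C.
- by rewrite exprn_ge0 // ltW.
- by rewrite exprn_ilt1 // ltW.
- exact: ltW.
- by [].
- exact: ltW.
- by [].
- by [].
move=> D [q [D0 q0 q1 sq]] i a b; exists (g^-1 * D), q; split=> //.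
  by rewrite mulr_gt0 ?invr_gt0.
move=> k; have := norm_le_gauge i a b (gs k); rewrite !ffunE !mxE.
by move=> /le_trans; apply; rewrite -mulrA ler_pM2l ?invr_gt0.
Qed.

End JumpOperator.

(** * Path sums and the laws of the chains *)

Section Paths.
Variable N : nat.

(** Trajectories [z_0, ..., z_k] as left-nested pairs: the last state splits off by computation, as
    recursions in time require, and finiteness turns expectations into finite sums. *)
Fixpoint path_type (k : nat) : finType :=
  if k is l.+1 then (path_type l * 'I_N)%type : finType else 'I_N : finType.

Definition path_last k : path_type k -> 'I_N :=
  match k return path_type k -> 'I_N with
  | 0%N => fun t => t
  | l.+1 => fun t => t.2
  end.

Fixpoint path_of (z : nat -> 'I_N) k : path_type k :=
  match k return path_type k with
  | 0%N => z 0%N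
  | l.+1 => (path_of z l, z l.+1)
  end.

Lemma path_last_of z k : path_last (path_of z k) = z k.
Proof. by case: k. Qed.

(** Indices beyond [k] fall through to the initial state, since [markov_chain] speaks of total
    sequences. *)
Fixpoint path_coord k : path_type k -> nat -> 'I_N :=
  match k return path_type k -> nat -> 'I_N with
  | 0%N => fun t _ => t
  | l.+1 => fun t m => if m == l.+1 then t.2 else path_coord t.1 m
  end.

Lemma path_coord_last k (t : path_type k) : path_coord t k = path_last t.
Proof. by case: k t => //= k t; rewrite eqxx. Qed.

Lemma path_ofP z k (t : path_type k) :
  path_of z k = t <-> forall l, (l <= k)%N -> z l = path_coord t l.
Proof.
elim: k t => [|k IH] t /=.
  by split=> [<- [|//]|/(_ 0%N) ->].
split=> [<- l lk|tz].
  case: eqP => [->//|/eqP lk1] /=; apply: (IH _).1 => //.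
  by rewrite -ltnS ltn_neqAle lk1.
rewrite [RHS]surjective_pairing; congr (_, _).
  by apply/IH => l lk; rewrite tz ?leqW // ltn_eqF.
by rewrite tz // eqxx.
Qed.

Variables (R : realType) (nu : 'rV[R]_N) (p : 'M[R]_N).

Fixpoint path_weight k : path_type k -> R :=
  match k return path_type k -> R with
  | 0%N => fun t => nu 0 t
  | l.+1 => fun t => path_weight t.1 * p (path_last t.1) t.2
  end.

Lemma path_weight_ge0 k (t : path_type k) :
  (forall i, 0 <= nu 0 i) -> (forall i j, 0 <= p i j) -> 0 <= path_weight t.
Proof. by move=> nu0 p0; elim: k t => //= k IH t; rewrite mulr_ge0. Qed.

Section PathSums.
Variable W : lmodType R.

(** This is [E[g 1(z_k = j)]] for a function [g] of the trajectory up to time [k]. *)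
Definition path_sum k (g : path_type k -> W) (j : 'I_N) : W :=
  \sum_(t | path_last t == j) path_weight t *: g t.

Lemma path_sum0 (g : path_type 0 -> W) j : path_sum g j = nu 0 j *: g j.
Proof. by rewrite /path_sum big_pred1_eq. Qed.

(** The Markov property in summed form, for integrands that ignore the newest state. *)
Lemma path_sumS k (g : path_type k -> W) j :
  path_sum (fun t : path_type k.+1 => g t.1) j =
  \sum_i p i j *: path_sum g i.
Proof.
transitivity (\sum_(t : path_type k) (path_weight t * p (path_last t) j) *: g t).
  rewrite /path_sum /=.
  rewrite -(pair_big xpredT (fun l => l == j)
    (fun t l => (path_weight t * p (path_last t) l) *: g t)) /=.
  by apply: eq_bigr => t _; rewrite big_pred1_eq.
rewrite (partition_big (@path_last k) xpredT) //=; apply: eq_bigr => i _.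
rewrite scaler_sumr; apply: eq_bigr => t /eqP <-.
by rewrite scalerA mulrC.
Qed.

Lemma path_sum_last k (g : 'I_N -> path_type k -> W) j :
  path_sum (fun t => g (path_last t) t) j = path_sum (g j) j.
Proof. by apply: eq_bigr => t /eqP ->. Qed.

Lemma path_sumE k (g : path_type k -> W) :
  \sum_t path_weight t *: g t = \sum_j path_sum g j.
Proof. by rewrite (partition_big (@path_last k) xpredT). Qed.

Variables (step : 'I_N -> W -> W) (x0 : W).

(** The state at time [k] uses [z_0, ..., z_(k-1)] only; this is what makes [path_sumS] applicable
    to it. *)
Fixpoint path_state k : path_type k -> W :=
  match k return path_type k -> W with
  | 0%N => fun=> x0
  | l.+1 => fun t => step (path_last t.1) (path_state t.1)
  end.

Lemma path_state_of (z : nat -> 'I_N) (x : nat -> W) k :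
  x 0%N = x0 -> (forall l, x l.+1 = step (z l) (x l)) ->
  path_state (path_of z k) = x k.
Proof.
by move=> x0E xS; elim: k => [|k IH] //=; rewrite path_last_of IH xS.
Qed.

End PathSums.

Lemma path_sum_linear (W W' : lmodType R) (L : {linear W -> W'}) k
    (g : path_type k -> W) j : path_sum (fun t => L (g t)) j = L (path_sum g j).
Proof. by rewrite linear_sum; apply: eq_bigr => t _; rewrite linearZ. Qed.

Lemma path_sumD (W : lmodType R) k (g h : path_type k -> W) j :
  path_sum (fun t => g t + h t) j = path_sum g j + path_sum h j.
Proof. by rewrite -big_split; apply: eq_bigr => t _; rewrite scalerDr. Qed.

Lemma path_sum_cst (W : lmodType R) k (x : W) j :
  path_sum (fun _ : path_type k => x) j =
  path_sum (fun _ : path_type k => 1 : R^o) j *: x.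
Proof.
rewrite scaler_suml; apply: eq_bigr => t _; congr (_ *: _).
by rewrite -[RHS]/(_ * 1) mulr1.
Qed.

Section MarkovChain.
Context {disp : measure_display} {Omega : measurableType disp}.
Variables (P : probability Omega R) (z : nat -> Omega -> 'I_N).
Hypothesis zP : markov_chain P nu p z.

Let Z k w := path_of (z^~ w) k.

Lemma path_measurable k t : measurable [set w | Z k w = t].
Proof.
have [mz _ _] := zP; elim: k t => [|k IH] t; first exact: mz.
rewrite (_ : [set _ | _] = [set w | Z k w = t.1] `&` [set w | z k.+1 w = t.2]).
  exact: measurableI.
apply/seteqP; split=> w /=; rewrite /Z /=; first by move=> <-.
by case=> -> ->; rewrite -surjective_pairing.
Qed.

Lemma path_prob k t : P [set w | Z k w = t] = (path_weight t)%:E.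
Proof.
have [_ z0 zS] := zP; elim: k t => [|k IH] t; first exact: z0.
have cylE m (u : path_type m) (i : nat -> 'I_N) :
    (forall l, (l <= m)%N -> i l = path_coord u l) ->
    [set w | Z m w = u] = [set w | forall l, (l <= m)%N -> z l w = i l].
  move=> iu; apply/seteqP; split=> w /=.
    by move=> /path_ofP h l lm; rewrite iu // h.
  by move=> h; apply/path_ofP => l lm; rewrite h // iu.
rewrite (cylE _ _ (path_coord t)) // zS -(cylE _ t.1) ?IH; last first.
  by move=> l lk /=; rewrite ltn_eqF.
by rewrite -EFinM /= eqxx ltn_eqF // path_coord_last.
Qed.

(** The integrand takes finitely many values, so it is a combination of indicators of trajectory
    events, and integrability is automatic. *)
Lemma path_expectation k (g : path_type k -> R) :
  ('E_P[fun w => g (Z k w)] = (\sum_t path_weight t * g t)%:E)%E.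
Proof.
rewrite unlock.
have -> : (\int[P]_w (g (Z k w))%:E =
    \int[P]_w \sum_t ((g t)%:E * (\1_[set w | Z k w = t] w)%:E))%E.
  apply: eq_integral => w _; rewrite (bigD1 (Z k w)) //= [X in (_ + X)%E]big1.
    by rewrite adde0 indicE mem_set // mule1.
  move=> t tZ; rewrite indicE memNset ?mule0 //= => ZE.
  by rewrite ZE eqxx in tZ.
have int_indic t : P.-integrable setT
    (fun w => (\1_[set w | Z k w = t] w)%:E : \bar R).
  by apply: integrable_indic; apply: path_measurable.
rewrite integral_sum //; last by move=> t; apply: integrableZl.
rewrite -sumEFin; apply: eq_bigr => t _.
rewrite integralZl // integral_indic //; last exact: path_measurable.
by rewrite setIT [X in (_ * X)%E]path_prob -EFinM mulrC.
Qed.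

Lemma path_event k (D : pred (path_type k)) :
  P [set w | D (Z k w)] = (\sum_(t | D t) path_weight t)%:E.
Proof.
have mD : measurable [set w | D (Z k w)].
  rewrite (_ : [set _ | _] = \bigcup_(t in [set t | D t]) [set w | Z k w = t]).
    apply: fin_bigcup_measurable; first exact: finite_finset.
    by move=> t _; apply: path_measurable.
  by apply/seteqP; split=> w /= => [DZ|[t Dt ->] //]; exists (Z k w).
rewrite -expectation_indic //.
have -> : \1_[set w | D (Z k w)] = (fun w => (D (Z k w))%:R : R).
  by apply/funext => w; rewrite indicE; congr (nat_of_bool _)%:R;
    apply/idP/idP; rewrite inE.
rewrite (path_expectation (fun t => (D t)%:R)); congr EFin.
rewrite [RHS]big_mkcond; apply: eq_bigr => t _.
by case: (D t); rewrite ?mulr1 ?mulr0.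
Qed.

End MarkovChain.

End Paths.

(** The inverse of 1 plus the sum of the inverses lies below every value and is positive even for
    empty [I]. *)
Lemma finite_pos_lb (R : realType) (I : finType) (f : I -> R) :
  (forall i, 0 < f i) -> exists2 c, 0 < c & forall i, c <= f i.
Proof.
move=> f0; pose S := 1 + \sum_i (f i)^-1.
have sum0 : 0 <= \sum_i (f i)^-1 by apply: sumr_ge0 => i _; rewrite invr_ge0 ltW.
have S0 : 0 < S by rewrite ltr_pwDl.
exists S^-1 => [|i]; first by rewrite invr_gt0.
rewrite -[leRHS]invrK lef_pV2 ?posrE ?invr_gt0 //.
rewrite /S (bigD1 i) //= addrCA lerDl addr_ge0 //.
by apply: sumr_ge0 => j _; rewrite invr_ge0 ltW.
Qed.

(** * Chains with a positive transition matrix *)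

Section PositiveChain.
Variables (R : realType) (n : nat) (q : 'M[R]_n) (w : 'rV[R]_n).
Hypotheses (q_gt0 : forall s t, 0 < q s t) (q1 : forall s, \sum_t q s t = 1).
Hypothesis w_stat : stationary q w.

Lemma stationaryE t : w 0 t = \sum_s w 0 s * q s t.
Proof. by have [_ {1}<-] := w_stat; rewrite mxE. Qed.

Lemma stationary_gt0 t : 0 < w 0 t.
Proof.
have [c c0 qc] := @finite_pos_lb R _ (fun s => q s t) (fun s => q_gt0 s t).
have [[w0 w1] _] := w_stat; rewrite stationaryE; apply: lt_le_trans c0 _.
rewrite -[leLHS]mul1r -w1 mulr_suml ler_sum // => s _.
by rewrite ler_wpM2l.
Qed.

(* Doeblin: subtracting the uniform minorant [c] of the kernel leaves a
   contraction of signed measures of mass 0. *)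
Lemma positive_chain_expcvg (m : nat -> 'I_n -> R) :
  \sum_s m 0%N s = 1 -> (forall k t, m k.+1 t = \sum_s m k s * q s t) ->
  forall s, expcvg (fun k => m k s) (w 0 s).
Proof.
move=> m0 mS s0.
have [c c0 qc] := @finite_pos_lb R ('I_n * 'I_n)%type _ (fun s => q_gt0 s.1 s.2).
have [[_ w1] _] := w_stat.
pose D k s := m k s - w 0 s; pose a k := \sum_s `|D k s|.
have msum k : \sum_s m k s = 1.
  elim: k => // k IH; under eq_bigr do rewrite mS.
  rewrite exchange_big -[RHS]IH; apply: eq_bigr => s _.
  by rewrite -mulr_sumr q1 mulr1.
have Dsum k : \sum_s D k s = 0 by rewrite sumrB msum w1 subrr.
have rho_def : \sum_(t < n) (q s0 t - c) = 1 - c *+ n.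
  by rewrite sumrB q1 sumr_const card_ord.
have rho0 : 0 <= 1 - c *+ n.
  rewrite -rho_def sumr_ge0 // => t _; rewrite subr_ge0; exact: (qc (s0, t)).
have rho1 : 1 - c *+ n < 1.
  by rewrite ltrBlDr ltrDl pmulrn_lgt0 // (leq_ltn_trans _ (ltn_ord s0)).
have aS k : a k.+1 <= (1 - c *+ n) * a k + 0 * 0 ^+ k.
  rewrite mul0r addr0 mulr_sumr.
  apply: (@le_trans _ _ (\sum_t \sum_s `|D k s| * (q s t - c))).
    apply: ler_sum => t _.
    have -> : D k.+1 t = \sum_s D k s * (q s t - c).
      under [RHS]eq_bigr do rewrite mulrBr; rewrite sumrB -mulr_suml Dsum mul0r subr0.
      under [RHS]eq_bigr do rewrite mulrBl.
      by rewrite sumrB -mS -stationaryE.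
    apply: le_trans (ler_norm_sum _ _ _) _; apply: ler_sum => s _.
    rewrite normrM [X in _ * X]ger0_norm // subr_ge0; exact: (qc (s, t)).
  rewrite exchange_big ler_sum // => s _ /=.
  rewrite -mulr_sumr mulrC ler_wpM2r //.
  by rewrite sumrB q1 sumr_const card_ord.
have a0 k : 0 <= a k by apply: sumr_ge0.
have [//|//|//|//|//|K [t [K0 t0 t1 aK]]] :=
  @geometric_comparison R a (1 - c *+ n) 0 0 rho0 rho1.
exists K, t; split=> // k; apply: le_trans (aK k).
by rewrite /a (bigD1 s0) //= lerDl sumr_ge0.
Qed.

(** Maximum principle: at a maximizer the gaps [h m - h t] are nonnegative and average to 0 with
    positive weights. *)
Lemma positive_harmonic_cst (h : 'I_n -> R) :
  (forall s, h s = \sum_t q s t * h t) -> forall s t, h s = h t.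
Proof.
move=> hq s; have [m _ hm] := @arg_maxP _ _ _ s xpredT h isT.
suff max_eq t : h t = h m by move=> t; rewrite !max_eq.
have : \sum_t q m t * (h m - h t) = 0.
  under eq_bigr do rewrite mulrBr.
  by rewrite sumrB -mulr_suml q1 mul1r -hq subrr.
move/eqP; rewrite psumr_eq0 => [/allP/(_ t)|u _]; last first.
  by apply: mulr_ge0; [exact: ltW|rewrite subr_ge0; exact: hm].
rewrite mem_index_enum mulf_eq0 gt_eqF //= subr_eq0.
by move=> /(_ isT) /eqP.
Qed.

End PositiveChain.

(** * The chain of consecutive pairs *)

Section PairChain.
Variables (R : realType) (n : nat) (q : 'M[R]_n) (w : 'rV[R]_n).
Variables (idx : 'I_n * 'I_n -> 'I_(n * n)) (st : 'I_(n * n) -> 'I_n * 'I_n).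
Hypotheses (idxK : cancel idx st) (stK : cancel st idx).
Hypothesis q_stoch : stochastic q.

Let p := pair_mx st q.

Lemma sum_pair (f : 'I_n -> 'I_n -> R) :
  \sum_i f (st i).1 (st i).2 = \sum_s' \sum_s f s' s.
Proof.
rewrite pair_bigA (reindex st) //=.
by exists idx => x _; rewrite ?idxK ?stK.
Qed.

(** A transition forces the newer state of [i] to be the older state of [j]; only the older state of
    [i] remains to be summed. *)
Lemma pair_mx_suml (f : 'I_(n * n) -> R) j :
  \sum_i f i * p i j =
  (\sum_s f (idx ((st j).2, s))) * q (st j).2 (st j).1.
Proof.
transitivity (\sum_i f (idx ((st i).1, (st i).2)) *
    (if (st j).2 == (st i).1 then q (st i).1 (st j).1 else 0)).
  by apply: eq_bigr => i _; rewrite -surjective_pairing stK mxE.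
rewrite (sum_pair (fun s' s => f (idx (s', s)) *
  (if (st j).2 == s' then q s' (st j).1 else 0))) (bigD1 (st j).2) //=.
rewrite eqxx -mulr_suml [X in _ + X]big1 ?addr0 // => s' s'j.
by rewrite big1 // => s _; rewrite eq_sym (negPf s'j) mulr0.
Qed.

Lemma pair_mx_sumr (f : 'I_(n * n) -> R) i :
  \sum_j p i j * f j = \sum_s q (st i).1 s * f (idx (s, (st i).1)).
Proof.
transitivity (\sum_j (if (st j).2 == (st i).1 then q (st i).1 (st j).1 else 0) *
    f (idx ((st j).1, (st j).2))).
  by apply: eq_bigr => j _; rewrite -surjective_pairing stK mxE.
rewrite (sum_pair (fun s' s => (if s == (st i).1 then q (st i).1 s' else 0) *
  f (idx (s', s)))); apply: eq_bigr => s' _.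
rewrite (bigD1 (st i).1) //= eqxx big1 ?addr0 // => s si.
by rewrite (negPf si) mul0r.
Qed.

Lemma pair_mx_stochastic : stochastic p.
Proof.
have [q0 q1] := q_stoch; split=> [i j|i]; first by rewrite mxE; case: ifP.
under eq_bigr do rewrite -[p _ _]mulr1.
rewrite (pair_mx_sumr (fun=> 1)) -[RHS](q1 (st i).1).
by apply: eq_bigr => s _; rewrite mulr1.
Qed.

(* A zero entry of [q] gives a zero column of [p], hence a state without
   return times, whose set of return times has every [g] as divisor. *)
Lemma aperiodic_pair_gt0 : aperiodic_mx p -> forall s s', 0 < q s s'.
Proof.
move=> aper s s'; have [q0 _] := q_stoch.
rewrite lt_neqAle q0 andbT; apply/eqP => /esym qss'.
suff : 2%N = 1%N by [].
apply: (aper (idx (s', s))) => -[//|k] _.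
rewrite exprSr -[_ * p]/(_ *m _) mxE big1 ?ltxx // => i _.
rewrite [p _ _]mxE idxK /=; case: eqP => [<-|]; last by rewrite mulr0.
by rewrite qss' mulr0.
Qed.

Hypotheses (q_gt0 : forall s s', 0 < q s s') (w_stat : stationary q w).

Definition pair_stationary i : R := w 0 (st i).2 * q (st i).2 (st i).1.

Local Notation pinf := pair_stationary.

Lemma pair_stationary_gt0 i : 0 < pinf i.
Proof. by rewrite mulr_gt0 // (stationary_gt0 q_gt0). Qed.

Lemma pair_stationary_sum1 : \sum_i pinf i = 1.
Proof.
have [_ q1] := q_stoch; have [[_ w1] _] := w_stat.
rewrite (sum_pair (fun s' s => w 0 s * q s s')) exchange_big -[RHS]w1.
by apply: eq_bigr => s _; rewrite -mulr_sumr q1 mulr1.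
Qed.

Lemma pair_stationaryP j : \sum_i pinf i * p i j = pinf j.
Proof.
rewrite pair_mx_suml; congr (_ * _); rewrite [RHS](stationaryE w_stat).
by apply: eq_bigr => s _; rewrite /pinf idxK.
Qed.

(** The pair matrix has zero entries once [n > 1], so minorization is applied to the marginal [m] of
    the newer state, which evolves by [q] and determines the pair law one step later. *)
Lemma pair_chain_expcvg (x : nat -> 'I_(n * n) -> R) :
  \sum_i x 0%N i = 1 -> (forall k j, x k.+1 j = \sum_i p i j * x k i) ->
  forall j, expcvg (fun k => x k j) (pinf j).
Proof.
move=> x0 xS j; pose m k s := \sum_u x k (idx (s, u)).
have xSE k i : x k.+1 i = m k (st i).2 * q (st i).2 (st i).1.
  by rewrite xS -pair_mx_suml; apply: eq_bigr => l _; rewrite mulrC.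
apply: expcvg_shift.
have [_ q1] := q_stoch.
have m0 : \sum_s m 0%N s = 1.
  rewrite /m -(sum_pair (fun s u => x 0%N (idx (s, u)))) -[RHS]x0.
  by apply: eq_bigr => i _; rewrite -surjective_pairing stK.
have mS k t : m k.+1 t = \sum_s m k s * q s t.
  by rewrite {1}/m; apply: eq_bigr => u _; rewrite xSE idxK.
have := positive_chain_expcvg q_gt0 q1 w_stat m0 mS (st j).2.
move=> /(expcvgMl (q (st j).2 (st j).1)); rewrite mulrC; apply: eq_expcvg => k.
by rewrite xSE mulrC.
Qed.

Lemma pair_harmonic_cst (h : 'I_(n * n) -> R) :
  (forall i, h i = \sum_j p i j * h j) -> forall i j, h i = h j.
Proof.
move=> hp i j; pose k s := \sum_t q s t * h (idx (t, s)).
have hE l : h l = k (st l).1 by rewrite hp pair_mx_sumr.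
have [_ q1] := q_stoch.
rewrite !hE; apply: (positive_harmonic_cst q_gt0 q1) => s.
by rewrite {1}/k; apply: eq_bigr => t _; rewrite hE idxK.
Qed.

(** The pair law at time [k] is the law of [s_k] times one transition, and the law of [s_k]
    converges to [w]. *)
Lemma limit_probE disp (Omega : measurableType disp) (P : probability Omega R)
    (nu0 : 'rV[R]_n) (s : nat -> Omega -> 'I_n) :
  markov_chain P nu0 q s -> limit_prob idx P s = pinf.
Proof.
move=> hs; apply/funext => i.
pose m k := path_sum nu0 q (fun _ : path_type n k => 1 : R^o).
have probE k : P [set w | pair_process idx s k w = i] =
    (m k (st i).2 * q (st i).2 (st i).1)%:E.
  pose D (t : path_type n k.+1) := (path_last t.1 == (st i).2) && (t.2 == (st i).1).
  transitivity (P [set w | D (path_of (s^~ w) k.+1)]).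
    congr (P _); apply/seteqP; split=> w0; rewrite /pair_process /D /= path_last_of.
      by move=> <-; rewrite idxK /= !eqxx.
    by move=> /andP[/eqP -> /eqP ->]; rewrite -surjective_pairing stK.
  rewrite (path_event hs); congr EFin.
  rewrite /D /= -(pair_big (fun t => path_last t == (st i).2)
    (fun l => l == (st i).1) (fun t l => path_weight nu0 q t * q (path_last t) l)).
  rewrite /m /path_sum mulr_suml; apply: eq_bigr => t /eqP ti.
  by rewrite big_pred1_eq -[_ *: _]/(_ * 1) mulr1 ti.
have [_ q1] := q_stoch.
have m_cvg := positive_chain_expcvg q_gt0 q1 w_stat (m := m).
have {}m_cvg : expcvg (fun k => m k (st i).2) (w 0 (st i).2).
  apply: m_cvg => [|k t].
    have := path_event hs (k := 0) xpredT.
    have -> : [set w | xpredT (path_of (s^~ w) 0)] = setT.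
      by apply/seteqP; split.
    rewrite probability_setT => -[->].
    by apply: eq_bigr => t _; rewrite /m path_sum0 -[_ *: _]/(_ * 1) mulr1.
  rewrite /m (path_sumS nu0 q (fun _ : path_type n k => 1 : R^o)).
  by apply: eq_bigr => l _; apply: mulrC.
rewrite /limit_prob; under eq_fun do rewrite probE.
apply: (congr1 fine (y := (pinf i)%:E)); apply/cvg_lim => //.
apply: cvg_EFin; first exact: nearW.
apply: (expcvg_cvg (u := fun k => _)).
rewrite /pinf mulrC; apply: eq_expcvg (expcvgMl _ m_cvg).
by move=> k /=; rewrite mulrC.
Qed.

End PairChain.

(** * The step-size bound *)

(** In the step-size bound a zero denominator, with quotient [+oo], belongs to the semidefinite
    cases, which are treated apart. *)
Lemma lte_divP (R : realType) (a x y : R) :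
  0 < y -> (a%:E < x%:E / y%:E)%E -> a * y < x.
Proof.
by move=> y0; rewrite inver gt_eqF // -EFinM lte_fin ltr_pdivlMr.
Qed.

(* [t] lies below the positive root of [l2 t^2 + l t + c], which is concave. *)
Lemma concave_quadratic_gt0 (R : realType) (l l2 c t : R) :
  0 < c -> l2 < 0 -> 0 < t ->
  t < (- l - Num.sqrt (l ^+ 2 - 4 * l2 * c)) / (2 * l2) ->
  0 < c + t * l + t ^+ 2 * l2.
Proof.
move=> c0 l20 t0; set D := l ^+ 2 - _; set s := Num.sqrt D.
have l2t0 : 2 * l2 < 0 by rewrite pmulr_rlt0.
have D0 : 0 <= D by rewrite /D; nra.
have s0 : 0 <= s by apply: sqrtr_ge0.
have sD : s ^+ 2 = D by apply: sqr_sqrtr.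
rewrite ltr_ndivlMr // => ts.
have ls : l < s.
  rewrite ltNge; apply/negP => sl.
  have : s ^+ 2 <= l ^+ 2 by rewrite lerXn2r // nnegrE (le_trans s0).
  rewrite sD /D; nra.
(* Completing the square: [4 l2 (l2 t^2 + l t + c) = (2 l2 t + l)^2 - D], where [4 l2] is
   negative. *)
have : (t * (2 * l2) + l) ^+ 2 < D.
  rewrite -sD; have : 0 < (s - (t * (2 * l2) + l)) * (s + (t * (2 * l2) + l)).
    by apply: mulr_gt0; [nra|lra].
  by rewrite -subr_sqr subr_gt0.
rewrite /D => h.
have : 4 * l2 * (c + t * l + t ^+ 2 * l2) < 0 by nra.
by rewrite nmulr_rlt0 // pmulr_rlt0.
Qed.

Section StepSize.
Variables (R : realType) (N n : nat).
Variables (A : 'I_N -> 'M[R]_n.+1) (p : 'M[R]_N) (pinf : 'I_N -> R).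
Variables (G : 'M[R]_n.+1) (Gt : 'I_N -> 'M[R]_n.+1) (alpha : R).
Hypothesis p1 : forall i, \sum_j p i j = 1.
Hypothesis pinf_gt0 : forall i, 0 < pinf i.
Hypothesis pinf_stat : forall j, \sum_i pinf i * p i j = pinf j.
Hypothesis harmonic_cst : forall h : 'I_N -> R,
  (forall i, h i = \sum_j p i j * h j) -> forall i j, h i = h j.
Variable last : 'I_N.
Hypothesis lastE : last.+1 = N.
Hypothesis hurwitzA : hurwitz (mean_A A pinf).
Hypothesis lyapG : lyapunov_eq A pinf G.
Hypothesis poissonG : poisson_eq A p pinf G Gt.
Hypothesis alpha_gt0 : 0 < alpha.
Hypothesis alpha_lt : (alpha%:E < step_bound A p pinf G Gt)%E.

Let c i := (pinf i * N%:R)^-1.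

Lemma weight_gt0 i : 0 < pinf i * N%:R.
Proof. by rewrite mulr_gt0 // ltr0n (leq_ltn_trans _ (ltn_ord i)). Qed.

Lemma inv_weight_gt0 i : 0 < c i.
Proof. by rewrite invr_gt0 weight_gt0. Qed.

Lemma Gt_last : Gt last = 0.
Proof. by have [-> //] := poissonG. Qed.

Lemma ltn_lastP i : i != last -> (i.+1 < N)%N.
Proof.
move=> il; rewrite ltn_neqAle ltn_ord andbT; apply: contra il => /eqP iN.
by apply/eqP/val_inj/succn_inj; rewrite iN lastE.
Qed.

(* The omitted equation at the last index follows by averaging all of them
   against the stationary law. *)
Lemma poisson_all i : Gt i - next_G p Gt i = bound_X A pinf G i.
Proof.
have nextE j : \sum_(k < N | (k.+1 < N)%N) p j k *: Gt k = next_G p Gt j.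
  rewrite /next_G [RHS](bigD1 last) //= Gt_last scaler0 add0r.
  apply: eq_bigl => k; case: eqP => [->|/eqP kl]; last by rewrite ltn_lastP.
  by rewrite lastE ltnn.
have not_last j : j != last -> Gt j - next_G p Gt j = bound_X A pinf G j.
  by move=> jl; have [_ <-] := poissonG; rewrite ?nextE ?ltn_lastP.
have [->|/not_last //] := eqVneq i last.
pose E j := Gt j - next_G p Gt j - bound_X A pinf G j.
have avgE : \sum_j pinf j *: E j = 0.
  under eq_bigr do rewrite !scalerBr; rewrite !sumrB.
  have -> : \sum_j pinf j *: next_G p Gt j = \sum_j pinf j *: Gt j.
    under eq_bigr do rewrite scaler_sumr; rewrite exchange_big.
    apply: eq_bigr => k _; rewrite -[in RHS]pinf_stat scaler_suml.
    by apply: eq_bigr => j _; rewrite scalerA.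
  rewrite subrr sub0r; apply/eqP; rewrite oppr_eq0; apply/eqP.
  rewrite /bound_X; under eq_bigr do rewrite !scalerDr; rewrite !big_split /=.
  have -> : \sum_j pinf j *: ((A j)^T *m G) = (mean_A A pinf)^T *m G.
    rewrite linear_sum /= mulmx_suml; apply: eq_bigr => j _.
    by rewrite linearZ /= scalemxAl.
  have -> : \sum_j pinf j *: (G *m A j) = G *m mean_A A pinf.
    by rewrite mulmx_sumr; apply: eq_bigr => j _; rewrite scalemxAr.
  rewrite lyapG; apply/eqP; rewrite addrC subr_eq0; apply/eqP.
  under eq_bigr do rewrite scalerA; rewrite -scaler_suml.
  rewrite (eq_bigr (fun=> N%:R^-1)) => [|j _].
    rewrite sumr_const card_ord -[_^-1 *+ _]mulr_natr mulVf ?scale1r //.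
    by rewrite pnatr_eq0 -lastE.
  by rewrite invfM mulrA divff ?mul1r // gt_eqF.
have : pinf last *: E last = 0.
  rewrite -[RHS]avgE (bigD1 last) //= big1 ?addr0 // => j /not_last jE.
  by rewrite /E jE subrr scaler0.
move/eqP; rewrite scaler_eq0 gt_eqF //= subr_eq0 => /eqP //.
Qed.

Lemma G_sym : G^T = G.
Proof. exact: (lyapunov_sym hurwitzA lyapG). Qed.

(** As [bound_X] is symmetric, each entry of [Gt^T - Gt] is harmonic for [p], hence constant in the
    index; it vanishes at [last]. *)
Lemma Gt_sym i : (Gt i)^T = Gt i.
Proof.
pose D j := (Gt j)^T - Gt j.
have DE j : D j = \sum_k p j k *: D k.
  have X_sym : (bound_X A pinf G j)^T = bound_X A pinf G j.
    rewrite /bound_X !linearD /= linearZ /= trmx1 !trmx_mul trmxK G_sym.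
    by rewrite [X in X + _]addrC.
  have GtE : Gt j = bound_X A pinf G j + next_G p Gt j.
    by rewrite -poisson_all subrK.
  rewrite /D {1 2}GtE linearD /= X_sym opprD addrACA subrr add0r.
  rewrite /next_G linear_sum -sumrB; apply: eq_bigr => k _.
  by rewrite linearZ /= scalerBr.
apply/eqP; rewrite -subr_eq0 -/(D i); apply/eqP/matrixP => a b.
rewrite (harmonic_cst (h := fun j => D j a b) _ i last).
  by rewrite /D Gt_last trmx0 subrr.
by move=> j; rewrite {1}DE summxE; apply: eq_bigr => k _; rewrite mxE.
Qed.

Lemma next_G_sym i : (next_G p Gt i)^T = next_G p Gt i.
Proof. by rewrite linear_sum; apply: eq_bigr => j _; rewrite linearZ /= Gt_sym. Qed.

Lemma bound_M_sym i : (bound_M A p G Gt i)^T = bound_M A p G Gt i.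
Proof.
rewrite /bound_M !linearB /= linearN /= !trmx_mul trmxK G_sym next_G_sym mulmxA.
by rewrite addrAC.
Qed.

Lemma bound_Mt_sym i : (bound_Mt A p Gt i)^T = bound_Mt A p Gt i.
Proof. by rewrite /bound_Mt linearN /= !trmx_mul trmxK next_G_sym mulmxA. Qed.

Lemma alpha_ltP i : (alpha%:E < alpha_bar A p pinf G Gt i)%E /\
  (alpha%:E < ratio_G G Gt i)%E.
Proof.
move: alpha_lt; rewrite /step_bound (bigminD1 i) // lt_min => /andP[].
by rewrite lt_min => /andP[].
Qed.

(** This is the Lyapunov decrement, cubic in [alpha], divided by [alpha]. The cases follow
    [alpha_bar]: a semidefinite form is dropped, any other is replaced by its [lambda_min]. *)
Lemma cubic_form_pos i : exists2 e, 0 < e & forall u, e * sqnorm u <=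
  c i * sqnorm u + alpha * bform (bound_M A p G Gt i) u u +
  alpha ^+ 2 * bform (bound_Mt A p Gt i) u u.
Proof.
have [+ _] := alpha_ltP i; rewrite /alpha_bar.
set M := bound_M _ _ _ _ _; set Mt := bound_Mt _ _ _ _.
have lM u : lambda_min M * sqnorm u <= bform M u u.
  exact: lambda_min_le (bound_M_sym i).
have lMt u : lambda_min Mt * sqnorm u <= bform Mt u u.
  exact: lambda_min_le (bound_Mt_sym i).
have a2 : 0 < alpha ^+ 2 by rewrite exprn_gt0.
have c0 := inv_weight_gt0 i.
case: ifPn => [/asboolP Mt_psd|/asboolPn Mt_npsd] alpha_bd; last first.
  exists (c i + alpha * lambda_min M + alpha ^+ 2 * lambda_min Mt) => [|u].
    by apply: concave_quadratic_gt0 => //; exact: lambda_min_lt0 (bound_Mt_sym i) Mt_npsd.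
  rewrite !mulrDl; apply: lerD; last first.
    by rewrite -[leLHS]mulrA (ler_pM2l a2).
  by rewrite lerD2l -mulrA ler_pM2l.
have Mt0 u : 0 <= bform Mt u u by have [_] := Mt_psd; apply.
case: (pselect (psd M)) => M_psd.
  have M0 u : 0 <= bform M u u by have [_] := M_psd; apply.
  by exists (c i) => // u; rewrite -addrA lerDl addr_ge0 ?mulr_ge0 // ltW.
move: alpha_bd; rewrite /psd_ind asboolF // subr0 mulr1.
have lM0 : lambda_min M < 0 by exact: lambda_min_lt0 (bound_M_sym i) M_psd.
move=> /lte_divP; rewrite ltr0_norm // => lt1.
have {}lt1 : alpha * (pinf i * N%:R * - lambda_min M) < 1.
  by apply: lt1; rewrite mulr_gt0 ?weight_gt0 // oppr_gt0.
exists (c i + alpha * lambda_min M) => [|u].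
  rewrite -ltrBlDr sub0r -(ltr_pM2l (weight_gt0 i)) divff ?gt_eqF ?weight_gt0 //.
  by apply: le_lt_trans lt1; rewrite le_eqVlt -mulrN mulrCA eqxx.
rewrite mulrDl -addrA lerD2l -mulrA -[leLHS]addr0 lerD ?ler_pM2l //.
by rewrite mulr_ge0 // ltW.
Qed.

Definition jump_lyapunov i := G + alpha *: Gt i.

(** For semidefinite [Gt i] the ratio bound is void and positivity comes from [G] alone; otherwise
    the bound says exactly that the sum of the two eigenvalue estimates is positive. *)
Lemma jump_lyapunov_pos i : exists2 g, 0 < g &
  forall u, g * sqnorm u <= bform (jump_lyapunov i) u u.
Proof.
have [_ +] := alpha_ltP i; rewrite /ratio_G /psd_ind.
case: (pselect (psd (Gt i))) => Gt_psd.
  move=> _; have [g g0 gG] := lyapunov_pos hurwitzA lyapG.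
  exists g => // u; rewrite bformD bformZ; apply: le_trans (gG u) _.
  by rewrite lerDl mulr_ge0 // ?(ltW alpha_gt0) //; have [_] := Gt_psd; apply.
have l0 := lambda_min_lt0 (Gt_sym i) Gt_psd.
rewrite asboolF // subr0 mulr1 ltr0_norm // => /lte_divP; rewrite oppr_gt0.
move=> /(_ l0) lt_l; exists (lambda_min G + alpha * lambda_min (Gt i)) => [|u].
  by move: lt_l; rewrite mulrN -subr_gt0 opprK.
rewrite bformD bformZ mulrDl -mulrA lerD ?ler_pM2l //.
  exact: lambda_min_le G_sym.
exact: lambda_min_le (Gt_sym i).
Qed.

(** At order [alpha] the coefficient [A^T G + G A + next_G - Gt] collapses to [- c I] by the Poisson
    equation: [Gt] cancels the deviation of each mode from the averaged equation. Orders 2 and 3 are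
    [- M] and [- Mt]. *)
Lemma jump_lyapunov_step i u :
  bform (\sum_j p i j *: jump_lyapunov j)
    ((1%:M + alpha *: A i) *m u) ((1%:M + alpha *: A i) *m u) =
  bform (jump_lyapunov i) u u - alpha * (c i * sqnorm u +
    alpha * bform (bound_M A p G Gt i) u u +
    alpha ^+ 2 * bform (bound_Mt A p Gt i) u u).
Proof.
have -> : \sum_j p i j *: jump_lyapunov j = G + alpha *: next_G p Gt i.
  under eq_bigr do rewrite scalerDr; rewrite big_split /= -scaler_suml p1.
  rewrite scale1r scaler_sumr; congr (_ + _); apply: eq_bigr => j _.
  by rewrite !scalerA mulrC.
rewrite -bform_congr -bform1 -!bformZ -!bformD -!bformZ -bformN -bformD.
congr bform; rewrite /jump_lyapunov.
have -> : Gt i = next_G p Gt i + bound_X A pinf G i.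
  by rewrite -poisson_all addrC subrK.
rewrite /bound_M /bound_Mt /bound_X -/(c i); move: (next_G p Gt i) => S.
have -> : (1%:M + alpha *: A i)^T = 1%:M + alpha *: (A i)^T.
  by rewrite linearD /= linearZ /= trmx1.
rewrite !(mulmxDl, mulmxDr, mulmx1, mul1mx).
rewrite -!(scalemxAl, scalemxAr).
apply/matrixP => a b; rewrite !mxE; ring.
Qed.

Lemma jump_lyapunov_contraction : exists r g, [/\ 0 < r, r < 1, 0 < g,
  (forall i u, g * sqnorm u <= bform (jump_lyapunov i) u u) &
  forall i u, bform (\sum_j p i j *: jump_lyapunov j)
    ((1%:M + alpha *: A i) *m u) ((1%:M + alpha *: A i) *m u) <=
    r ^+ 4 * bform (jump_lyapunov i) u u].
Proof.
have cubicP i : exists e, 0 < e /\ forall u, e * sqnorm u <=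
    c i * sqnorm u + alpha * bform (bound_M A p G Gt i) u u +
    alpha ^+ 2 * bform (bound_Mt A p Gt i) u u.
  by have [e e0 eP] := cubic_form_pos i; exists e.
have posP i : exists g, 0 < g /\
    forall u, g * sqnorm u <= bform (jump_lyapunov i) u u.
  by have [g g0 gP] := jump_lyapunov_pos i; exists g.
have [e' e'P] := choice cubicP; have [g' g'P] := choice posP.
have [e e0 ee'] := finite_pos_lb (fun i => (e'P i).1).
have [g g0 gg'] := finite_pos_lb (fun i => (g'P i).1).
have ae0 : 0 < alpha * e by rewrite mulr_gt0.
(* [S] bounds every form from above relative to [|u|^2]; the added [alpha * e + 1] ensures
   [0 < x]. *)
pose S := \sum_i (mxnorm1 (jump_lyapunov i) *+ 2) + alpha * e + 1.
have S1 : 0 <= \sum_i (mxnorm1 (jump_lyapunov i) *+ 2).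
  by apply: sumr_ge0 => i _; rewrite mulrn_wge0 // mxnorm1_ge0.
have S0 : 0 < S by rewrite ltr_wpDl // addr_ge0 // ltW.
pose x := 1 - alpha * e / S.
have x0 : 0 < x.
  by rewrite subr_gt0 ltr_pdivrMr // mul1r /S addrAC ltrDr ltr_wpDl.
have x1 : x < 1 by rewrite ltrBlDr ltrDl divr_gt0.
(* A fourth root, since the jump operator expects its contraction factor as [r ^+ 4]. *)
exists (Num.sqrt (Num.sqrt x)), g; split=> // [||i u|i u].
- by rewrite !sqrtr_gt0.
- by rewrite -sqrtr1 ltr_sqrt // -sqrtr1 ltr_sqrt.
- have [_ g'u] := g'P i; apply: le_trans (g'u u).
  by rewrite ler_wpM2r ?sqnorm_ge0.
have -> : Num.sqrt (Num.sqrt x) ^+ 4 = x.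
  by rewrite (exprM _ 2 2) !sqr_sqrtr ?sqrtr_ge0 // ltW.
rewrite jump_lyapunov_step /x mulrBl mul1r lerD2l lerN2.
have [_ e'u] := e'P i.
apply: (@le_trans _ _ (alpha * (e * sqnorm u))); last first.
  rewrite ler_pM2l //; apply: le_trans (e'u u).
  by rewrite ler_wpM2r ?sqnorm_ge0.
rewrite [leRHS]mulrA -[leLHS]mulrA (ler_pM2l ae0) ler_pdivrMl //.
apply: le_trans (ler_norm _) _; apply: le_trans (bform_le _ _ _) _.
have -> : mxnorm1 (jump_lyapunov i) * (sqnorm u + sqnorm u) =
    (mxnorm1 (jump_lyapunov i) *+ 2) * sqnorm u.
  by rewrite -mulr2n mulrnAr mulrnAl.
rewrite ler_wpM2r ?sqnorm_ge0 // /S (bigD1 i) //= mulr2n -!addrA addrA lerDl.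
rewrite addr_ge0 ?addr_ge0 ?(ltW ae0) //.
by apply: sumr_ge0 => j _; rewrite mulrn_wge0 // mxnorm1_ge0.
Qed.

End StepSize.

(** * Moments *)

Section MatrixConvergence.
Variable R : realType.

Definition mxexpcvg m n (X : nat -> 'M[R]_(m, n)) (L : 'M[R]_(m, n)) :=
  forall a b, expcvg (fun k => X k a b) (L a b).

Lemma mxexpcvgD m n (X Y : nat -> 'M[R]_(m, n)) L M :
  mxexpcvg X L -> mxexpcvg Y M -> mxexpcvg (fun k => X k + Y k) (L + M).
Proof.
move=> XL YM a b; rewrite mxE; apply: eq_expcvg (expcvgD (XL a b) (YM a b)).
by move=> k; rewrite mxE.
Qed.

Lemma mxexpcvg_mul m n l q (A : 'M[R]_(l, m)) (B : 'M[R]_(n, q))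
    (X : nat -> 'M[R]_(m, n)) L :
  mxexpcvg X L -> mxexpcvg (fun k => A *m X k *m B) (A *m L *m B).
Proof.
move=> XL a b.
have mulE (Y : 'M[R]_(m, n)) : (A *m Y *m B) a b =
    \sum_j \sum_i (B j b * A a i) * Y i j.
  rewrite mxE; apply: eq_bigr => j _; rewrite mxE mulr_suml.
  by apply: eq_bigr => i _; rewrite mulrC mulrA.
rewrite mulE; apply: (@eq_expcvg _ (fun k => \sum_j \sum_i (B j b * A a i) * X k i j)).
  by move=> k; rewrite mulE.
by do 2!(apply: expcvg_sum => ? _); apply: expcvgMl.
Qed.

Lemma mxexpcvg_tr m n (X : nat -> 'M[R]_(m, n)) L :
  mxexpcvg X L -> mxexpcvg (fun k => (X k)^T) L^T.
Proof.
by move=> XL a b; rewrite mxE; apply: eq_expcvg (XL b a) => k; rewrite mxE.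
Qed.

Lemma mxexpcvg_scale m n (x : nat -> R) l (Y : 'M[R]_(m, n)) :
  expcvg x l -> mxexpcvg (fun k => x k *: Y) (l *: Y).
Proof.
move=> xl a b; rewrite mxE mulrC; apply: eq_expcvg (expcvgMl (Y a b) xl).
by move=> k; rewrite mxE mulrC.
Qed.

Lemma mxexpcvg_sum m n (I : finType) (p : I -> R)
    (X : I -> nat -> 'M[R]_(m, n)) (L : I -> 'M[R]_(m, n)) :
  (forall i, mxexpcvg (X i) (L i)) ->
  mxexpcvg (fun k => \sum_i p i *: X i k) (\sum_i p i *: L i).
Proof.
move=> XL a b; rewrite summxE.
apply: (@eq_expcvg _ (fun k => \sum_i p i * X i k a b)).
  by move=> k; rewrite summxE; apply: eq_bigr => i _; rewrite mxE.
by apply: expcvg_sum => i _; rewrite mxE; apply: expcvgMl; apply: XL.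
Qed.

End MatrixConvergence.

(** * Moments of a Markov jump linear system *)

Section JumpLinearSystem.
Variables (R : realType) (N d : nat) (p : 'M[R]_N) (pinf : 'I_N -> R).
Variables (H G : 'I_N -> 'M[R]_d) (beta : 'I_N -> 'cV[R]_d) (r g : R).
Hypotheses (p_ge0 : forall i j, 0 <= p i j) (p1 : forall i, \sum_j p i j = 1).
Hypothesis law_cvg : forall x : nat -> 'I_N -> R, \sum_i x 0%N i = 1 ->
  (forall k j, x k.+1 j = \sum_i p i j * x k i) ->
  forall j, expcvg (fun k => x k j) (pinf j).
Hypotheses (r_gt0 : 0 < r) (r_lt1 : r < 1) (g_gt0 : 0 < g).
Hypothesis G_contr : forall i u,
  bform (\sum_j p i j *: G j) (H i *m u) (H i *m u) <= r ^+ 4 * bform (G i) u u.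
Hypothesis G_ge : forall i u, g * sqnorm u <= bform (G i) u u.

Definition jump_step i (x : 'cV[R]_d) := H i *m x + beta i.

Section Moments.
Variables (nu : 'rV[R]_N) (x0 : 'cV[R]_d).

(** This and the next two families are [P(z_k = j)], [E[x_k 1(z_k = j)]] and
    [E[x_k x_k^T 1(z_k = j)]]. *)
Definition jump_law k j : R :=
  path_sum nu p (fun _ : path_type N k => 1 : R^o) j.

Definition jump_mean k j : 'cV[R]_d :=
  path_sum nu p (fun t : path_type N k => path_state jump_step x0 t) j.

Definition jump_moment k j : 'M[R]_d :=
  path_sum nu p (fun t : path_type N k =>
    path_state jump_step x0 t *m (path_state jump_step x0 t)^T) j.

Lemma jump_lawS k j : jump_law k.+1 j = \sum_i p i j * jump_law k i.
Proof. exact: (path_sumS nu p (fun _ : path_type N k => 1 : R^o)). Qed.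

Lemma jump_meanS k j : jump_mean k.+1 j =
  \sum_i p i j *: (H i *m jump_mean k i + jump_law k i *: beta i).
Proof.
rewrite /jump_mean /= (path_sumS nu p (fun t : path_type N k =>
  jump_step (path_last t) (path_state jump_step x0 t))).
apply: eq_bigr => i _; congr (_ *: _).
rewrite (path_sum_last nu p (fun i t => jump_step i (path_state jump_step x0 t))).
by rewrite path_sumD path_sum_cst (path_sum_linear nu p (mulmx (H i))).
Qed.

Lemma jump_momentS k j : jump_moment k.+1 j =
  \sum_i p i j *: (H i *m jump_moment k i *m (H i)^T +
    (H i *m jump_mean k i *m (beta i)^T + beta i *m (jump_mean k i)^T *m (H i)^T +
     jump_law k i *: (beta i *m (beta i)^T))).
Proof.
pose sq i x := jump_step i x *m (jump_step i x)^T.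
rewrite /jump_moment /= (path_sumS nu p (fun t : path_type N k =>
  sq (path_last t) (path_state jump_step x0 t))).
apply: eq_bigr => i _; congr (_ *: _).
rewrite (path_sum_last nu p (fun i t => sq i (path_state jump_step x0 t))).
have sqE x : sq i x = H i *m (x *m x^T) *m (H i)^T +
    (H i *m x *m (beta i)^T + beta i *m x^T *m (H i)^T + beta i *m (beta i)^T).
  rewrite /sq /jump_step linearD /= trmx_mul mulmxDl !mulmxDr !mulmxA.
  by rewrite -!addrA.
have -> : path_sum nu p (fun t : path_type N k =>
      sq i (path_state jump_step x0 t)) i =
    path_sum nu p (fun t : path_type N k => H i *m
      (path_state jump_step x0 t *m (path_state jump_step x0 t)^T) *m (H i)^T +
     (H i *m path_state jump_step x0 t *m (beta i)^T +
      beta i *m (path_state jump_step x0 t)^T *m (H i)^T +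
      beta i *m (beta i)^T)) i.
  by rewrite /path_sum; apply: eq_bigr => t _; rewrite sqE.
have mulE m n q l (X : 'M[R]_(m, l)) (f : path_type N k -> 'M[R]_(l, q))
    (Y : 'M[R]_(q, n)) :
    path_sum nu p (fun t => X *m f t *m Y) i = X *m path_sum nu p f i *m Y.
  rewrite /path_sum mulmx_sumr mulmx_suml; apply: eq_bigr => t _.
  by rewrite -scalemxAr -scalemxAl.
rewrite !path_sumD path_sum_cst !mulE; congr (_ + (_ + _ *m _ *m _ + _)).
rewrite /jump_mean /path_sum linear_sum; apply: eq_bigr => t _.
by rewrite linearZ.
Qed.

Hypothesis nu1 : \sum_i nu 0 i = 1.

Lemma jump_law_cvg j : expcvg (fun k => jump_law k j) (pinf j).
Proof.
apply: law_cvg => [|k i]; last exact: jump_lawS.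
rewrite -[RHS]nu1; apply: eq_bigr => i _.
by rewrite /jump_law path_sum0 -[_ *: _]/(_ * 1) mulr1.
Qed.

End Moments.

(** For means the right-hand forms are the identity, with lower constant 1; both sides must share
    one constant. *)
Let g' := Num.min g 1.

Lemma jump_g'_gt0 : 0 < g'.
Proof. by rewrite lt_min g_gt0 ltr01. Qed.

Lemma jump_G_ge i u : g' * sqnorm u <= bform (G i) u u.
Proof.
apply: le_trans (G_ge i u); rewrite ler_wpM2r ?sqnorm_ge0 //.
by rewrite ge_min lexx.
Qed.

Lemma jump_mean_cvg : exists q : 'I_N -> 'cV[R]_d, forall (nu : 'rV[R]_N) (x0 : 'cV[R]_d),
  \sum_i nu 0 i = 1 -> forall i, mxexpcvg (fun k => jump_mean nu x0 k i) (q i).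
Proof.
(* The right factor preserves its form exactly, because the rows of [p] sum to 1; the strict
   contraction of [G] is enough. *)
pose one := fun _ : 'I_N => 1%:M : 'M[R]_1.
pose f : {ffun 'I_N -> 'cV[R]_d} := [ffun j => \sum_i p i j *: (pinf i *: beta i)].
have one_contr i v : bform (\sum_j p i j *: one j) (one i *m v) (one i *m v) <=
    bform (one i) v v.
  by rewrite -scaler_suml p1 scale1r mul1mx.
have one_ge (i : 'I_N) v : g' * sqnorm v <= bform (one i) v v.
  by rewrite bform1 ler_piMl ?sqnorm_ge0 // ge_min lexx orbT.
have [q qP] := jump_recursion_cvg p_ge0 r_gt0 r_lt1 jump_g'_gt0 G_contr
  one_contr jump_G_ge one_ge f.
exists q => nu x0 nu1 i a b.
pose x k : {ffun 'I_N -> 'cV[R]_d} := [ffun j => jump_mean nu x0 k j].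
pose y k : {ffun 'I_N -> 'cV[R]_d} :=
  [ffun j => \sum_i p i j *: (jump_law nu k i *: beta i)].
apply: (@eq_expcvg _ (fun k => x k i a b)) => [k|]; first by rewrite ffunE.
apply: (qP x y) => [k|j a' b'].
  apply/ffunP => j; rewrite !ffunE jump_meanS -big_split; apply: eq_bigr => l _ /=.
  by rewrite ffunE scalerDr /one trmx1 mulmx1.
rewrite /f ffunE; apply: (@eq_expcvg _ (fun k => (\sum_i p i j *:
  (jump_law nu k i *: beta i)) a' b')) => [k|]; first by rewrite ffunE.
apply: mxexpcvg_sum => l; apply: mxexpcvg_scale; exact: jump_law_cvg.
Qed.

Lemma jump_moment_cvg : exists Q : 'I_N -> 'M[R]_d,
  forall (nu : 'rV[R]_N) (x0 : 'cV[R]_d),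
  \sum_i nu 0 i = 1 -> forall i, mxexpcvg (fun k => jump_moment nu x0 k i) (Q i).
Proof.
have [q qP] := jump_mean_cvg.
pose z (m : 'I_N -> 'cV[R]_d) (l : 'I_N -> R) i :=
  H i *m m i *m (beta i)^T + beta i *m (m i)^T *m (H i)^T +
  l i *: (beta i *m (beta i)^T).
pose f : {ffun 'I_N -> 'M[R]_d} := [ffun j => \sum_i p i j *: z q pinf i].
have r4 : r ^+ 4 <= 1 by rewrite exprn_ile1 // ltW.
have G_contr' i v : bform (\sum_j p i j *: G j) (H i *m v) (H i *m v) <=
    bform (G i) v v.
  apply: le_trans (G_contr i v) _; rewrite ler_piMl //.
  by apply: le_trans (G_ge i v); rewrite mulr_ge0 ?sqnorm_ge0 // ltW.
have [Q QP] := jump_recursion_cvg p_ge0 r_gt0 r_lt1 g_gt0 G_contr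
  G_contr' G_ge G_ge f.
exists Q => nu x0 nu1 i a b.
pose x k : {ffun 'I_N -> 'M[R]_d} := [ffun j => jump_moment nu x0 k j].
pose y k : {ffun 'I_N -> 'M[R]_d} :=
  [ffun j => \sum_i p i j *: z (jump_mean nu x0 k) (jump_law nu k) i].
apply: (@eq_expcvg _ (fun k => x k i a b)) => [k|]; first by rewrite ffunE.
apply: (QP x y) => [k|j a' b'].
  apply/ffunP => j; rewrite !ffunE jump_momentS -big_split.
  by apply: eq_bigr => l _ /=; rewrite ffunE -scalerDr.
rewrite /f ffunE; apply: (@eq_expcvg _ (fun k => (\sum_i p i j *:
  z (jump_mean nu x0 k) (jump_law nu k) i) a' b')) => [k|]; first by rewrite ffunE.
apply: mxexpcvg_sum => l; apply: mxexpcvgD.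
  apply: mxexpcvgD; first exact: mxexpcvg_mul (qP nu x0 nu1 l).
  exact: mxexpcvg_mul (mxexpcvg_tr (qP nu x0 nu1 l)).
apply: mxexpcvg_scale; exact: jump_law_cvg.
Qed.

End JumpLinearSystem.

(** * TD(0) as a jump linear system *)

Section TD0Moments.
Variables (R : realType) (n d : nat) (gamma alpha : R).
Variables (phi : 'I_n -> 'cV[R]_d) (Rpi : 'I_n -> R) (Ppi : 'M[R]_n).
Variable theta_pi : 'cV[R]_d.
Variables (idx : 'I_n * 'I_n -> 'I_(n * n)) (st : 'I_(n * n) -> 'I_n * 'I_n).
Hypothesis idxK : cancel idx st.

Let A := td_A gamma phi st.
Let b := td_b gamma phi Rpi st theta_pi.
Let p := pair_mx st Ppi.

Definition td_step := jump_step (fun i => 1%:M + alpha *: A i)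
  (fun i => alpha *: b i).

Let td_state (theta0 : 'cV[R]_d) k (t : path_type (n * n) k) : 'cV[R]_d :=
  path_state td_step (theta0 - theta_pi) t.

(** The result depends on the probability space only through [nu] and [p], which makes limits and
    constants uniform over all realizations. *)
Lemma td_expectation theta0 nu disp (Omega : measurableType disp)
    (P : probability Omega R) (s : nat -> Omega -> 'I_n) k (f : 'cV[R]_d -> R) :
  markov_chain P nu p (pair_process idx s) ->
  ('E_P[fun w => f (td_error gamma phi Rpi alpha theta_pi s theta0 k w)])%E =
  (\sum_(t : path_type (n * n) k) path_weight nu p t *
    f (td_state theta0 t))%:E.
Proof.
move=> zP; rewrite -(path_expectation zP (k := k) (fun t =>
  f (td_state theta0 t))).
congr expectation; apply/funext => w; congr f; apply/esym.
apply: (path_state_of (x := fun k =>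
  td_error gamma phi Rpi alpha theta_pi s theta0 k w)) => // l.
rewrite (td_errorS _ _ _ _ _ _ _ _ _ idxK) /td_step /jump_step mulmxDl mul1mx -scalemxAl.
by rewrite scalerDr addrA.
Qed.

Variables (r g : R) (G : 'I_(n * n) -> 'M[R]_d) (pinf : 'I_(n * n) -> R).
Hypothesis p_stoch : stochastic p.
Hypothesis law_cvg : forall x : nat -> 'I_(n * n) -> R, \sum_i x 0%N i = 1 ->
  (forall k j, x k.+1 j = \sum_i p i j * x k i) ->
  forall j, expcvg (fun k => x k j) (pinf j).
Hypotheses (r_gt0 : 0 < r) (r_lt1 : r < 1) (g_gt0 : 0 < g).
Hypothesis G_contr : forall i u, bform (\sum_j p i j *: G j)
    ((1%:M + alpha *: A i) *m u) ((1%:M + alpha *: A i) *m u) <=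
  r ^+ 4 * bform (G i) u u.
Hypothesis G_ge : forall i u, g * sqnorm u <= bform (G i) u u.

Lemma td_mean_cvg : exists mu : 'cV[R]_d,
  forall (nu : 'rV[R]_(n * n)) theta0, prob_vector nu -> forall a,
  expcvg (fun k => \sum_(t : path_type (n * n) k) path_weight nu p t *
    td_state theta0 t a 0) (mu a 0).
Proof.
have [p0 p1] := p_stoch.
have [q qP] := jump_mean_cvg (fun i => alpha *: b i) p0 p1 law_cvg
  r_gt0 r_lt1 g_gt0 G_contr G_ge.
exists (\sum_i q i) => nu theta0 [_ nu1] a; rewrite summxE.
apply: eq_expcvg (expcvg_sum (fun i _ => qP nu (theta0 - theta_pi) nu1 i a 0)).
move=> k; rewrite -summxE /jump_mean -path_sumE summxE.
by apply: eq_bigr => t _; rewrite mxE.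
Qed.

Lemma td_moment_cvg : exists Q : 'M[R]_d,
  forall (nu : 'rV[R]_(n * n)) theta0, prob_vector nu -> forall a c,
  expcvg (fun k => \sum_(t : path_type (n * n) k) path_weight nu p t *
    (td_state theta0 t *m
     (td_state theta0 t)^T) a c) (Q a c).
Proof.
have [p0 p1] := p_stoch.
have [q qP] := jump_moment_cvg (fun i => alpha *: b i) p0 p1 law_cvg
  r_gt0 r_lt1 g_gt0 G_contr G_ge.
exists (\sum_i q i) => nu theta0 [_ nu1] a c; rewrite summxE.
apply: eq_expcvg (expcvg_sum (fun i _ => qP nu (theta0 - theta_pi) nu1 i a c)).
move=> k; rewrite -summxE /jump_moment -path_sumE summxE.
by apply: eq_bigr => t _; rewrite mxE.
Qed.

Lemma td_mean_square_stable :
  mean_square_stable gamma phi Rpi idx st Ppi alpha theta_pi.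
Proof.
have [mu muP] := td_mean_cvg; have [Q QP] := td_moment_cvg.
exists mu, Q => theta0 nu nuP disp Omega P s zP /=; split=> [a|a c].
  under eq_fun do rewrite (td_expectation theta0 _ (fun x => x a 0) zP).
  apply: cvg_EFin; first exact: nearW.
  exact: (expcvg_cvg (muP nu theta0 nuP a)).
under eq_fun do rewrite (td_expectation theta0 _ (fun x => (x *m x^T) a c) zP).
apply: cvg_EFin; first exact: nearW.
exact: (expcvg_cvg (QP nu theta0 nuP a c)).
Qed.

(** The squared error is the trace of the second moment, so its limit is [\tr Q]. The law [nu]
    exhibits [\tr Q] as a limit of nonnegative numbers. *)
Lemma td_error_cvg (nu : 'rV[R]_(n * n)) : prob_vector nu ->
  mean_square_error_converges_exponentially gamma phi Rpi idx st Ppi alpha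
    theta_pi.
Proof.
have [Q QP] := td_moment_cvg.
have errP (mu : 'rV[R]_(n * n)) theta0 : prob_vector mu ->
  expcvg (fun k => \sum_(t : path_type (n * n) k) path_weight mu p t *
    (\sum_a td_state theta0 t a 0 ^+ 2))
    (\tr Q).
  move=> muP; apply: eq_expcvg (expcvg_sum (fun a _ => QP mu theta0 muP a a)).
  move=> k; rewrite exchange_big; apply: eq_bigr => t _; rewrite mulr_sumr.
  by apply: eq_bigr => a _; rewrite mxE big_ord1 mxE expr2.
have [p0 _] := p_stoch.
move=> nuP; exists (\tr Q) => [|theta0 mu muP].
  apply: (cvgr_to_ge (expcvg_cvg (errP nu 0 nuP))); apply: nearW => k.
  apply: sumr_ge0 => t _; rewrite mulr_ge0 //.
    by apply: path_weight_ge0 => //; have [] := nuP.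
  by apply: sumr_ge0 => a _; rewrite sqr_ge0.
have [C [t [C0 t0 t1 Ct]]] := errP mu theta0 muP.
exists C, t; split=> // disp Omega P s zP /= k.
rewrite (td_expectation theta0 k (fun x => \sum_a x a 0 ^+ 2) zP).
by rewrite -EFinB lee_fin.
Qed.

End TD0Moments.

Theorem theorem3 (R : realType) (n d : nat) (n_gt0 : (0 < n)%N)
  (d_gt0 : (0 < d)%N)
  (Ppi : 'M[R]_n) (hPpi : stochastic Ppi)
  (Rpi : 'I_n -> R)
  (gamma : R) (hgamma : 0 < gamma < 1)
  (phi : 'I_n -> 'cV[R]_d)
  (disp : measure_display) (Omega : measurableType disp)
  (P : probability Omega R) (nu0 : 'rV[R]_n) (s : nat -> Omega -> 'I_n)
  (hs : markov_chain P nu0 Ppi s)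
  (w : 'rV[R]_n) (hw : stationary Ppi w)
  (Pi : 'M[R]_n) (hPi : weighted_projection w (feature_mx phi) Pi)
  (theta_pi : 'cV[R]_d)
  (htheta_pi : projected_bellman gamma phi Rpi Ppi Pi theta_pi)
  (idx : 'I_n * 'I_n -> 'I_(n * n)) (st : 'I_(n * n) -> 'I_n * 'I_n)
  (idxK : cancel idx st) (stK : cancel st idx) :
  let A := td_A gamma phi st in
  let b := td_b gamma phi Rpi st theta_pi in
  let p := pair_mx st Ppi in
  let pinf := limit_prob idx P s in
  irreducible_mx p -> aperiodic_mx p ->
  hurwitz (mean_A A pinf) ->
  \sum_i pinf i *: b i = 0 ->
  forall (Gbar : 'M[R]_d) (Gt : 'I_(n * n) -> 'M[R]_d),
  lyapunov_eq A pinf Gbar ->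
  poisson_eq A p pinf Gbar Gt ->
  forall alpha : R, 0 < alpha ->
  (alpha%:E < step_bound A p pinf Gbar Gt)%E ->
  mean_square_stable gamma phi Rpi idx st Ppi alpha theta_pi /\
  mean_square_error_converges_exponentially gamma phi Rpi idx st Ppi alpha
    theta_pi.
Proof.
move=> A b p pinf _ aper.
have q_gt0 := aperiodic_pair_gt0 idxK hPpi aper.
have [Ppi0 Ppi1] := hPpi.
have p_stoch : stochastic p by apply: (pair_mx_stochastic idxK stK).
have [p0 p1] := p_stoch.
(* In product form, positivity and stationarity of the limit law become algebraic. *)
have -> : pinf = pair_stationary Ppi w st.
  exact: (limit_probE idxK stK hPpi q_gt0 hw hs).
have pinf_gt0 := pair_stationary_gt0 st q_gt0 hw.
have pinf1 := pair_stationary_sum1 idxK stK hPpi hw.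
have pinf_stat := pair_stationaryP idxK stK hw.
have harm := pair_harmonic_cst idxK stK hPpi q_gt0.
have law := pair_chain_expcvg idxK stK hPpi q_gt0 hw.
have lastP : ((n * n).-1 < n * n)%N by rewrite ltn_predL muln_gt0 n_gt0.
have lastE : (Ordinal lastP).+1 = (n * n)%N.
  by rewrite /= prednK // muln_gt0 n_gt0.
(* The Lyapunov arguments are stated for matrices of size [n.+1]. *)
case: d d_gt0 phi theta_pi @A @b {hPi htheta_pi} => // d' _ phi' theta A b.
move=> hurwA _ G Gt lyapG poissonG alpha alpha0 alpha_lt.
have [r [g [r0 r1 g0 G_ge G_contr]]] := jump_lyapunov_contraction p1 pinf_gt0
  pinf_stat harm lastE hurwA lyapG poissonG alpha0 alpha_lt.
split.
  exact: (td_mean_square_stable Rpi theta idxK p_stoch law r0 r1 g0 G_contr G_ge).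
(* The stationary pair law is a probability vector at hand to witness nonnegativity of the limit. *)
apply: (td_error_cvg Rpi theta idxK p_stoch law r0 r1 g0 G_contr G_ge
  (nu := \row_i pair_stationary Ppi w st i)).
split=> [i|]; first by rewrite mxE ltW.
by rewrite -[RHS]pinf1; apply: eq_bigr => i _; rewrite mxE.
Qed.
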